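(* Assume the Continuum Hypothesis. Then there exists a separable, first countable, connected weird space of weight $\aleph_1$.
   Context: All topological spaces are assumed to be Hausdorff. A subset $P$ of a space $X$ is perfect iff $P$ is nonempty, closed, and has no isolated points (in the subspace topology). A space $X$ is scattered iff it has no perfect subset. A space $X$ is weird iff $X$ is compact and not scattered, and no perfect subset of $X$ is totally disconnected (a space is totally disconnected iff its only nonempty connected subsets are singletons). The weight of $X$ is the least infinite cardinality of a base for $X$. *)

(* Defs.v *)
From HB Require Import structures.
From mathcomp Require Import all_boot all_classical topology.

Set Implicit Arguments.
Unset Strict Implicit.
Unset Printing Implicit Defensive.

Local Open Scope classical_set_scope.
Local Open Scope card_scope.

(* |K| = aleph_1, the least uncountable cardinal *)
Definition has_card_aleph1 (U : Type) (K : set U) : Prop :=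
  ~ countable K /\
  forall (V : Type) (A : set V), ~ countable A -> K #<= A.

(* 2 ^ aleph_0 = aleph_1 *)
Definition continuum_hypothesis : Prop := has_card_aleph1 [set: set nat].

Section TopologicalNotions.
Variable X : topologicalType.

Definition perfect (P : set X) : Prop :=
  [/\ P !=set0, closed P & isolated P = set0].

Definition scattered : Prop := ~ exists P : set X, perfect P.

Definition weird : Prop :=
  [/\ compact [set: X], ~ scattered &
      forall P : set X, perfect P -> ~ totally_disconnected P].

Definition separable : Prop := exists2 D : set X, countable D & dense D.

Definition first_countable : Prop :=
  forall x : X, exists2 B : set (set X), countable B &
    B `<=` open_nbhs x /\
    forall V, nbhs x V -> exists2 U, B U & U `<=` V.

(* |K| is the least infinite cardinality of a base *)
Definition has_weight (U : Type) (K : set U) : Prop :=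
  [/\ infinite_set K,
      exists2 B : set (set X), basis B & B #= K &
      forall B : set (set X), basis B -> infinite_set B -> K #<= B].

End TopologicalNotions.

Arguments scattered : clear implicits.
Arguments weird : clear implicits.
Arguments separable : clear implicits.
Arguments first_countable : clear implicits.
Arguments has_weight X {U} K.

(* Main.v *)
(* The space is a closed subset [X] of [[0, 1] ^ omega_1]. At stage [alpha] at most
   one point [p] of the projection of [X] to the coordinates below [alpha] is
   split into a segment; over the other points the coordinate [alpha] is a
   continuous function [h], which oscillates between 0 and 1 near [p]. Since [h]
   oscillates along the preimage of every segment created before, a closed
   subset of [X] that projects onto such a segment contains its full preimage,
   which is connected. CH provides a list of all closed subsets [Q] of all
   countable subproducts; when [Q] is treated, [p] is chosen in [Q] and [h]
   oscillates along [Q], so that every closed [P] with projection [Q] contains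
   the preimage of a segment. Hence no perfect set is totally disconnected.

   For first countability every thread must be split only countably often. A
   thread [x] is frozen once a colour [F_mu(x|mu)] differs from [g(mu)]. The
   colouring [F], built by recursion over all tasks, takes all colour patterns on
   every uncountable closed set, so that unfrozen points [p] are always
   available; and [g] is chosen so that no thread follows it forever (a form of
   the weak diamond principle). *)
From HB Require Import structures.
Require Import Defs.
From mathcomp Require Import all_boot all_order all_algebra all_classical all_reals.
From mathcomp Require Import wochoice topology normedtype ring lra Rstruct.

Set Implicit Arguments.
Unset Strict Implicit.
Unset Printing Implicit Defensive.

Import Order.TTheory GRing.Theory Num.Theory numFieldNormedType.Exports.
Local Open Scope classical_set_scope.
Local Open Scope ring_scope.

(** * The first uncountable ordinal under CH *)

Definition small (T : Type) := exists f : T -> set nat, injective f.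

Lemma small_inj (S T : Type) (f : S -> T) : injective f -> small T -> small S.
Proof. by move=> fI [g gI]; exists (g \o f); exact: inj_comp. Qed.

Lemma small_set (C : countType) : small (set C).
Proof.
exists (fun A => [set n | exists2 x, A x & n = pickle x]) => A B.
move=> /seteqP[AB BA]; apply/seteqP; split=> x Ax.
- have /AB[y By /(pcan_inj pickleK)->//] : [set n | exists2 x, A x & n = pickle x] (pickle x) by exists x.
- have /BA[y By /(pcan_inj pickleK)->//] : [set n | exists2 x, B x & n = pickle x] (pickle x) by exists x.
Qed.

Lemma small_fun (T : Type) : small T -> small (nat -> T).
Proof.
case=> f fI; apply: (small_inj _ (small_set (nat * nat)%type)).
pose F (u : nat -> T) := [set p : nat * nat | f (u p.1) p.2].
suff : injective F by apply.
move=> u v uv; apply/funext => n; apply: fI; apply/seteqP; split=> m h.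
- by have : F v (n, m) by rewrite -uv.
- by have : F u (n, m) by rewrite uv.
Qed.

Lemma small_prod (S T : Type) : small S -> small T -> small (S * T).
Proof.
case=> f fI [g gI]; apply: (small_inj _ (small_set (nat + nat)%type)).
pose F (u : S * T) := [set p : nat + nat |
  match p with inl n => f u.1 n | inr n => g u.2 n end].
suff : injective F by apply.
move=> [x y] [x' y'] E; congr (_, _).
- apply: fI; apply/seteqP; split=> m h.
  + by have : F (x', y') (inl m) by rewrite -E.
  + by have : F (x, y) (inl m) by rewrite E.
- apply: gI; apply/seteqP; split=> m h.
  + by have : F (x', y') (inr m) by rewrite -E.
  + by have : F (x, y) (inr m) by rewrite E.
Qed.

Lemma small_real (R : realType) : small R.
Proof.
apply: (small_inj _ (small_set rat)).
pose F (x : R) := [set q : rat | ratr q < x].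
suff : injective F by apply.
have H (x y : R) : F x = F y -> ~ x < y.
  move=> E /rat_in_itvoo[q]; rewrite in_itv /= => /andP[xq qy].
  have : F x q by rewrite E.
  by rewrite /F /= ltNge (ltW xq).
by move=> x y E; case: (ltgtP x y) => [/(H _ _ E)|/(H _ _ (esym E))|].
Qed.

Lemma countable_setU (T : Type) (A B : set T) :
  countable A -> countable B -> countable (A `|` B).
Proof.
move=> cA cB; rewrite -bigcup2E.
apply: bigcup_countable => // -[|[|n]] _ //=; exact: countable0.
Qed.

(** The order type omega_1 as it is used below. The maps [idx1 a] number each closed initial segment
    by naturals; CH enters through [enum1], which lists any nonempty set of size at most the
    continuum along [o1]. *)
Record omega_one := OmegaOne {
  o1 :> choiceType;
  lt1 : o1 -> o1 -> Prop;
  bot1 : o1;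
  lt1_wf : well_founded lt1;
  bot1_min : forall a, ~ lt1 a bot1;
  lt1_trans : forall a b c, lt1 a b -> lt1 b c -> lt1 a c;
  lt1_total : forall a b, [\/ lt1 a b, a = b | lt1 b a];
  idx1 : o1 -> o1 -> nat;
  idx1_inj : forall a b c, ~ lt1 a b -> ~ lt1 a c -> idx1 a b = idx1 a c -> b = c;
  enum1 : forall T : Type, T -> small T -> exists e : o1 -> T, forall t, exists w, e w = t;
  small1 : small o1 }.

(** Well-order [set nat] and keep the points with countably many predecessors. They are uncountably
    many, since otherwise the least point left out would have countably many predecessors too. CH
    then injects [set nat] into them, and inverting this injection gives [enum1]. *)
Lemma omega_one_ex : continuum_hypothesis -> inhabited omega_one.
Proof.
move=> [unc minc].
pose T : eqType := {classic (set nat)}.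
have [R Rwo] := well_ordering_principle T.
have min (P : T -> Prop) : (exists x, P x) -> exists2 z, P z & forall y, P y -> R z y.
  move=> [x Px]; have [|z [[Pz zm] _]] := Rwo (fun y => `[< P y >]).
    by exists x; apply/asboolP.
  exists z; first by move: Pz => /asboolP.
  by move=> y Py; apply: zm; apply/asboolP.
have Rxx x : R x x by have [z <-] := min (fun y => y = x) (ex_intro _ x erefl); apply.
have Rtot x y : R x y \/ R y x.
  have [|z [->|->]] := min (fun z => z = x \/ z = y); first by exists x; left.
    by move=> h; left; apply: h; right.
  by move=> h; right; apply: h; left.
have Ranti x y : R x y -> R y x -> x = y.
  move=> xy yx; have [|z [[Pz zm] u]] := Rwo (fun z => (z == x) || (z == y)).
    by exists x; rewrite unfold_in eqxx.
  transitivity z; first apply/esym; apply: u; split; rewrite ?unfold_in ?eqxx ?orbT //.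
  - by move=> t; rewrite unfold_in => /orP[/eqP->|/eqP->].
  - by move=> t; rewrite unfold_in => /orP[/eqP->|/eqP->].
have Rtr x y z : R x y -> R y z -> R x z.
  move=> xy yz; have [|t Pt tm] := min (fun t => [\/ t = x, t = y | t = z]).
    by exists x; constructor 1.
  have tx : R t x by apply: tm; constructor 1.
  have ty : R t y by apply: tm; constructor 2.
  have tz : R t z by apply: tm; constructor 3.
  case: Pt => e; subst t => //.
  - by rewrite (Ranti _ _ xy tx).
  - have e : y = z by apply: Ranti.
    by rewrite -e.
pose Wp (x : T) : bool := `[< countable [set y | R y x] >].
pose W : choiceType := {x : T | Wp x}.
have Wunc : ~ countable [set x | Wp x].
  move=> cW; have [x nx xm] : exists2 z, ~ Wp z & forall y, ~ Wp y -> R z y.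
    apply: min; apply: contrapT => /forallNP h; apply: unc.
    apply: sub_countable cW; apply: subset_card_le => x _.
    by apply: contrapT => nW; exact: (h x).
  apply: nx; apply/asboolP.
  suff : [set y | R y x] `<=` [set y | Wp y] `|` [set x].
    move=> /subset_card_le /sub_countable; apply.
    by apply: countable_setU => //; exact: countable1.
  move=> y yx; have [Wy|nWy] := boolP (Wp y); first by left.
  by right; apply: Ranti => //; apply: xm; apply/negP.
pose lt (a b : W) := R (val a) (val b) /\ a <> b.
have lewf (a b : W) : ~ lt a b -> R (val b) (val a).
  move=> nab; case: (Rtot (val a) (val b)) => // ab.
  suff -> : a = b by [].
  by apply: contrapT => ne; apply: nab.
have tot a b : [\/ lt a b, a = b | lt b a].
  have [->|ne] := EM (a = b); first by constructor 2.
  case: (Rtot (val a) (val b)) => h; [constructor 1|constructor 3]; split=> //.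
  by move=> e; apply: ne.
have wf : well_founded lt.
  move=> a; apply: contrapT => na.
  have [|m [w [wm nw]] mm] := min (fun x => exists w : W, val w = x /\ ~ Acc lt w).
    by exists (val a); exists a.
  apply: nw; constructor => b [bw bne]; apply: contrapT => nb.
  apply: bne; apply: val_inj; apply: Ranti => //.
  by rewrite wm; apply: mm; exists b.
have WuncT : ~ countable [set: W].
  move=> cW; apply: Wunc.
  suff -> : [set x | Wp x] = val @` [set: W].
    by apply: sub_countable cW; exact: card_image_le.
  apply/seteqP; split=> [x Wx|_ [w _ <-]]; last exact: (valP w).
  by exists (Sub x Wx).
have [i0 _] : exists w : W, True.
  apply: contrapT => /forallNP h; apply: WuncT.
  suff -> : [set: W] = set0 by exact: countable0.
  by apply/seteqP; split=> w //= _; apply: (h w).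
have idx (a : W) : exists f : W -> nat, forall b c, ~ lt a b -> ~ lt a c -> f b = f c -> b = c.
  have /asboolP/countable_injP[f fI] := valP a.
  exists (f \o val) => b c /lewf ba /lewf ca /fI e.
  by apply: val_inj; apply: e; rewrite inE.
have [j jI] : exists j : set nat -> W, injective j.
  have /card_leP[f] := minc _ _ WuncT.
  exists (fun x => val (f (SigSub (mem_setT x)))) => x y /val_inj e.
  have := @inj _ _ _ f (SigSub (mem_setT x)) (SigSub (mem_setT y)).
  by rewrite !inE => /(_ I I e) [].
have en (S : Type) : S -> small S -> exists e : W -> S, forall t, exists w, e w = t.
  move=> s0 [f fI].
  exists (fun w => xget (s0 : {classic S}) [set s | j (f s) = w]) => t.
  exists (j (f t)); apply/fI/jI.
  exact: (@xgetPex {classic S} s0 [set s | j (f s) = j (f t)] (ex_intro _ t erefl)).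
have [idxf idxP] := choice idx.
have [b _] : exists b : W, True by exists i0.
have tr a b' c : lt a b' -> lt b' c -> lt a c.
  move=> [ab nab] [bc nbc]; split; first exact: Rtr bc.
  move=> e; subst c; apply: nab; apply: val_inj; exact: Ranti.
have [m mm] : exists m : W, forall x, ~ lt x m.
  elim/(well_founded_ind wf): b => x ih.
  have [[y yx]|h] := EM (exists y, lt y x); first exact: ih yx.
  by exists x => y yx; apply: h; exists y.
constructor; apply: (@OmegaOne W lt m wf mm tr tot idxf idxP en).
by exists (fun w => val w); exact: val_inj.
Qed.

(** * Recursion, counting and unpredictable functions on omega_1 *)

Section Combinatorics.
Variables (W : omega_one) (R : realType).
Implicit Types (a b d mu : W).
Local Notation lt := (@lt1 W).
Local Notation le a b := (~ lt1 b a).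

Lemma lt1_irr a : ~ lt a a.
Proof. by elim/(well_founded_ind (@lt1_wf W)): a => a ih aa; exact: (ih a). Qed.

Lemma lt1_le a b : lt a b -> le a b.
Proof. by move=> ab ba; exact: (lt1_irr (lt1_trans ab ba)). Qed.

Lemma lt1_le_trans b a c : lt a b -> le b c -> lt a c.
Proof.
move=> ab bc; case: (lt1_total b c) => [|<-//|//]; exact: lt1_trans.
Qed.

Lemma le1_lt_trans b a c : le a b -> lt b c -> lt a c.
Proof.
move=> ab bc; case: (lt1_total a b) => [|->//|//] h; exact: lt1_trans h bc.
Qed.

Lemma le1_trans b a c : le a b -> le b c -> le a c.
Proof. by move=> ab bc ca; apply: bc; exact: lt1_le_trans ca ab. Qed.

Lemma le1P a b : le a b -> a = b \/ lt a b.
Proof. by move=> h; case: (lt1_total a b); [right|left|]. Qed.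

Lemma bot1P a : a = bot1 W \/ lt (bot1 W) a.
Proof. by have [->|] := le1P (@bot1_min W a); [left|right]. Qed.

Lemma lt1_min (P : W -> Prop) : (exists a, P a) ->
  exists2 a, P a & forall b, lt b a -> ~ P b.
Proof.
move=> [a Pa]; elim/(well_founded_ind (@lt1_wf W)): a Pa => a ih Pa.
have [[b [ba Pb]]|h] := EM (exists b, lt b a /\ P b); first exact: ih ba Pb.
by exists a => // b ba Pb; apply: h; exists b.
Qed.

(** The history is a total function, masked by [a0] from [a] on, so that no dependent types enter
    the later constructions. *)
Lemma wf_rec (A : Type) (a0 : A) (G : W -> (W -> A) -> A) :
  exists f : W -> A,
    forall a, f a = G a (fun b => if `[< lt b a >] then f b else a0).
Proof.
pose H a (rec : forall b, lt b a -> A) : A :=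
  G a (fun b => if pselect (lt b a) is left h then rec b h else a0).
exists (Fix (@lt1_wf W) (fun=> A) H) => a; rewrite Fix_eq /H.
  congr G; apply/funext => b; case: pselect => h.
    by case: asboolP.
  by case: asboolP.
by move=> x f g fg; congr G; apply/funext => b; case: pselect.
Qed.

Lemma countable_below a : countable [set b | lt b a].
Proof.
apply/countable_injP; exists (idx1 a) => b c; rewrite !inE /= => ba ca.
by apply: idx1_inj; exact: lt1_le.
Qed.

Lemma countable_range (T : Type) (A : set T) (t0 : T) :
  countable A -> exists u : nat -> T, forall x, A x -> exists n, u n = x.
Proof.
move=> /countable_injP[f fI].
exists (fun n => xget (t0 : {classic T}) [set x | A x /\ f x = n]) => x Ax.
have [|Ay e] := @xgetPex {classic T} t0 [set y | A y /\ f y = f x].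
  by exists x.
by exists (f x); apply: fI => //; rewrite inE.
Qed.

Lemma range_countable (T : Type) (u : nat -> T) : countable (range u).
Proof. by apply: sub_countable (card_image_le _ _) _; exact: countableP. Qed.

(** Cantor's diagonal argument, as [enum1] maps the index set onto [set nat]. *)
Lemma uncountable_o1 : ~ countable [set: W].
Proof.
move=> /(countable_range (bot1 W))[u uP].
have [|e eP] := @enum1 W (set nat) set0; first by exists id.
have [w ew] := eP [set n | ~ e (u n) n].
have [n un] := uP w I.
have : e w n <-> ~ e w n by rewrite {1}ew /= un.
by tauto.
Qed.

Definition agree a (x y : W -> R) := forall b, lt b a -> x b = y b.

Lemma agree_refl a x : agree a x x. Proof. by []. Qed.
Lemma agree_sym a x y : agree a x y -> agree a y x.
Proof. by move=> h b ba; rewrite h. Qed.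
Lemma agree_trans a y x z : agree a x y -> agree a y z -> agree a x z.
Proof. by move=> h h' b ba; rewrite h // h'. Qed.
Lemma agree_le a b x y : le a b -> agree b x y -> agree a x y.
Proof. by move=> ab h c ca; apply: h; exact: lt1_le_trans ab. Qed.
Lemma agree_lt a b x y : lt a b -> agree b x y -> agree a x y.
Proof. by move=> /lt1_le; exact: agree_le. Qed.

Definition depends (T : Type) a (f : (W -> R) -> T) :=
  forall x y, agree a x y -> f x = f y.

(** In a listing of the pairs [(w, t)] each [t] occurs at uncountably many indices, and only
    countably many of them lie below [d]. *)
Lemma o1_enum_cofinal (T : Type) : T -> small T ->
  exists e : W -> T, forall t d, exists2 a, le d a & e a = t.
Proof.
move=> t0 sT.
have [|e eP] := @enum1 W (W * T)%type (bot1 W, t0).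
  exact: small_prod (small1 W) sT.
exists (fun a => (e a).2) => t d; apply: contrapT => h.
apply: uncountable_o1.
suff : [set: W] `<=` (fun a => (e a).1) @` [set b | lt b d].
  move=> /subset_card_le /sub_countable; apply.
  by apply: sub_countable (card_image_le _ _) _; exact: countable_below.
move=> w _; have [a ea] := eP (w, t); exists a; last by rewrite ea.
by apply: contrapT => da; apply: h; exists a => //; rewrite ea.
Qed.

(* A predictor that sees only [x] below [mu] cannot follow every [g]: if each
   [g] were followed by some [x = Phi g], then [g] would be determined by the
   bottom values of [g, Phi g, Phi (Phi g), ...], and there are only
   [#|W|]-many sequences of reals. *)
Lemma unpredictable (F : W -> (W -> R) -> R) :
  (forall mu, depends mu (F mu)) ->
  exists g : W -> R, forall x, exists2 mu, mu <> bot1 W & F mu x <> g mu.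
Proof.
move=> Fdep; apply: contrapT => /forallNP h.
have {h} /choice[Phi PhiP] : forall g : W -> R, exists x,
    forall mu, mu <> bot1 W -> F mu x = g mu.
  move=> g; have /existsNP[x hx] := h g; exists x => mu mu0.
  by apply: contrapT => ne; apply: hx; exists mu.
have [|e eP] := @enum1 W (nat -> R) (fun=> 0).
  by apply: small_fun; exact: small_real.
pose bots (g : W -> R) n := iter n Phi g (bot1 W).
have det g g' : bots g = bots g' -> g = g'.
  move=> E; apply/funext => a.
  suff : forall n, iter n Phi g a = iter n Phi g' a by move/(_ 0%N).
  elim/(well_founded_ind (@lt1_wf W)): a => a ih n.
  have [->|/eqP a0] := eqVneq a (bot1 W); first by have := congr1 (@^~ n) E.
  rewrite -(PhiP (iter n Phi g)) // -(PhiP (iter n Phi g')) //.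
  by apply: Fdep => b ba; exact: (ih b ba n.+1).
(* By [det] at most one function has the bottom sequence [e a]; [g] is chosen to differ from it at
   [a]. *)
pose g a : R := if `[< exists2 g', bots g' = e a & g' a = 0 >] then 1 else 0.
have [a ea] := eP (bots g).
have : g a = if `[< exists2 g', bots g' = e a & g' a = 0 >] then 1 else 0 by [].
case: asboolP => [[g' + g'a]|ng ga].
  by rewrite ea => /det gg'; rewrite -gg' g'a => /esym/eqP; rewrite oner_eq0.
by apply: ng; exists g.
Qed.

(** * A colouring that solves all tasks, and the selection of unfrozen points *)

Section Tasks.
Variables (C : Type) (c0 : C) (K : W -> C -> set (W -> R)).
Hypothesis smallC : small C.

(** The tasks are listed by [W]. A solution [z w] of each solvable task is chosen by recursion so
    that below [dl w] it differs from all earlier choices; hence the colours demanded by a task can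
    be written along its own solution without conflict. Uncountability of the projection leaves room
    to avoid countably many points. *)
Lemma colouring : exists F : W -> (W -> R) -> R,
  (forall mu, depends mu (F mu)) /\
  forall d a c (D : nat -> W -> R) (s : W -> R), le d a ->
    (forall D' : nat -> W -> R, exists2 x, K a c x & forall n, ~ agree d x (D' n)) ->
    exists z, [/\ K a c z, forall n, ~ agree d z (D n) &
      forall mu, le d mu -> le mu a -> F mu z = s mu].
Proof.
have [|t tP] := @enum1 W (W * W * C * (nat -> nat -> R))%type
    (bot1 W, bot1 W, c0, fun _ _ => 0).
  apply: small_prod; last by do 2 apply: small_fun; exact: small_real.
  by apply: small_prod => //; apply: small_prod; exact: small1.
pose dl w := (t w).1.1.1; pose al w := (t w).1.1.2; pose cc w := (t w).1.2.
(* The coordinates up to [al w] are numbered by [idx1], so a sequence of reals codes a function on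
   them: slot 0 is the colour pattern, slot [n.+1] the [n]-th point to avoid. *)
pose dec w n : W -> R := fun b => (t w).2 n (idx1 (al w) b).
pose good w (prev : W -> W -> R) := [set z | [/\ K (al w) (cc w) z,
  forall n, ~ agree (dl w) z (dec w n.+1) &
  forall v, lt v w -> ~ agree (dl w) z (prev v)]].
have [z zP] := wf_rec (fun=> 0 : R) (fun w prev => xget (fun=> 0 : R) (good w prev)).
have agood w : (exists x, good w z x) -> good w z (z w).
  move=> [x gx]; rewrite zP; set prev := (X in xget _ (good w X)).
  have prevE v : lt v w -> prev v = z v by rewrite /prev; case: asboolP.
  have [|z1 z2 z3] := @xgetPex _ (fun=> 0 : R) (good w prev).
    by exists x; case: gx => x1 x2 x3; split=> // v vw; rewrite prevE //; exact: x3.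
  by split=> // v vw; rewrite -(prevE v vw); exact: z3.
pose hit mu (x : W -> R) w :=
  [/\ good w z (z w), le (dl w) mu, le mu (al w) & agree mu x (z w)].
pose least mu x := [set w | hit mu x w /\ forall v, lt v w -> ~ hit mu x v].
exists (fun mu x => dec (xget (bot1 W) (least mu x)) 0%N mu); split.
  move=> mu x y xy; congr (dec (xget _ _) _ _).
  have hE v : hit mu x v = hit mu y v.
    apply/propext; split=> -[h1 h2 h3 h4]; split=> //.
      exact: agree_trans (agree_sym xy) h4.
    exact: agree_trans xy h4.
  apply/seteqP; split=> w; rewrite /least /= hE => -[hw h]; split=> // v /h.
    by rewrite hE.
  by rewrite hE.
move=> d a c D s da unc.
pose code n k : R := (if n is m.+1 then D m else s)
   (xget (bot1 W) [set b | le b a /\ idx1 a b = k]).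
have [w tw] := tP (d, a, c, code).
have decE n b : le b a -> dec w n b = (if n is m.+1 then D m else s) b.
  move=> ba; rewrite /dec /al tw /= /code.
  set X := [set b' | _]; have [|xa xe] := @xgetPex _ (bot1 W) X.
    by exists b.
  by have -> : xget (bot1 W) X = b by apply: idx1_inj xe.
have gz : good w z (z w).
  apply: agood.
  have [D1 D1P] := countable_range (fun=> 0) (sub_countable (card_image_le z _) (countable_below w)).
  pose D2 n := if odd n then D n./2 else D1 n./2.
  have [x Kx xD] := unc D2.
  exists x; rewrite /good /dl /al /cc tw /=; split=> // [n h|v vw h].
  - apply: (xD n.*2.+1); rewrite /D2 /= odd_double /= uphalf_double.
    move=> b bd; rewrite h // decE //.
    by apply: lt1_le; exact: lt1_le_trans da.
  - have [|n zn] := D1P (z v); first by exists v.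
    by apply: (xD n.*2); rewrite /D2 odd_double doubleK zn.
have [Kz zD _] := gz.
exists (z w); move: Kz zD; rewrite /al /cc /dl tw /= => Kz zD; split=> //.
  move=> n h; apply: (zD n) => b bd; rewrite h // decE //.
  by apply: lt1_le; exact: lt1_le_trans da.
move=> mu dmu mua.
have hw : hit mu (z w) w by split; rewrite // /dl /al tw.
suff -> : xget (bot1 W) (least mu (z w)) = w by rewrite decE.
have [v hv vm] := lt1_min (ex_intro (hit mu (z w)) w hw).
have : least mu (z w) (xget (bot1 W) (least mu (z w))).
  by apply: xgetPex; exists v.
move: (xget _ _) => u [[_ lx xl ag] xm].
(* An earlier [u] hit by [z w] would make [z w] agree with [z u] below [dl w], since [dl w] is at
   most [mu]; the choice of [z w] excludes this. *)
case: (lt1_total u w) => [uw|//|wu]; last by have := xm _ wu.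
have [_ _ /(_ u uw)] := gz; rewrite /dl tw /= => h; exfalso; apply: h.
exact: agree_le ag.
Qed.

(** [U mu x] says that the colour of [x] at [mu] is [g mu], for an unpredictable [g]. No [x] follows
    [g] at all stages above the bottom, but [g] may be prescribed as the pattern in [colouring], so
    sets with uncountable projection have points that follow it from [d] to [a]. *)
Lemma selector : exists U : W -> set (W -> R),
  [/\ forall mu, depends mu (U mu),
      forall x, exists2 mu, mu <> bot1 W & ~ U mu x &
  forall d a c (D : nat -> W -> R), le d a ->
    (forall D' : nat -> W -> R, exists2 x, K a c x & forall n, ~ agree d x (D' n)) ->
    exists z, [/\ K a c z, forall n, ~ agree d z (D n) &
      forall mu, le d mu -> le mu a -> U mu z]].
Proof.
have [F [Fd FP]] := colouring; have [g gP] := unpredictable Fd.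
exists (fun mu => [set x | F mu x = g mu]); split=> //.
  by move=> mu x y xy; rewrite /= (Fd mu x y).
by move=> d a c D da /(FP d a c D g da).
Qed.

End Tasks.
End Combinatorics.

(** * Compactness and metrics in the product space *)

(** The sets on which finitely many [f j] are small generate a proper filter, and a cluster point of
    it is a common zero. With coordinate differences for [f], approximate agreement on finite sets
    of coordinates becomes exact agreement. *)
Lemma compact_common_zero (R : realType) (T : topologicalType) (J : eqType)
    (K : set T) (P : set J) (f : J -> T -> R) :
  compact K ->
  (forall j k (e : R), 0 < e -> nbhs k [set y | `|f j y - f j k| < e]) ->
  (forall (F : seq J) (e : R), 0 < e ->
    exists2 k, K k & forall j, j \in F -> P j -> `|f j k| < e) ->
  exists2 k, K k & forall j, P j -> f j k = 0.
Proof.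
move=> cK cf h.
pose A (p : seq J * R) := [set k | K k /\ forall j, j \in p.1 -> P j -> `|f j k| < p.2].
pose FF := filter_from [set p : seq J * R | 0 < p.2] A.
have fFF : ProperFilter FF.
  apply: filter_from_proper.
    apply: filter_from_filter; first by exists ([::], 1) => /=.
    move=> [F1 e1] [F2 e2] /= e10 e20.
    exists (F1 ++ F2, Num.min e1 e2); first by rewrite /= lt_min e10.
    move=> k [/= Kk hk]; split; split=> //= j jF Pj.
      by have := hk j; rewrite mem_cat jF lt_min => /(_ isT Pj)/andP[].
    by have := hk j; rewrite mem_cat jF orbT lt_min => /(_ isT Pj)/andP[].
  by move=> [F e] /= /(h F)[k Kk hk]; exists k.
have [|k [Kk ck]] := cK FF fFF.
  by exists ([::], 1) => //= k [].
exists k => // j Pj; apply/eqP; apply: contrapT => /negP n0.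
have e0 : 0 < `|f j k| / 2 by rewrite divr_gt0 // normr_gt0.
have FA : FF (A ([:: j], `|f j k| / 2)) by exists ([:: j], `|f j k| / 2).
have nk := cf j k _ e0.
have [y [[_ /(_ j)]]] := ck _ _ FA nk.
rewrite /= inE eqxx => /(_ isT Pj) h1 h2.
have := ler_normB (f j y) (f j y - f j k).
rewrite opprB addrC subrK => /le_lt_trans /(_ (ltrD h1 h2)).
by rewrite -splitr ltxx.
Qed.

Section Coordinates.
Variables (W : omega_one) (R : realType).
Implicit Types (a b : W).
Local Notation lt := (@lt1 W).
Local Notation le a b := (~ lt1 b a).
Definition ospace := prod_topology (fun _ : W => R : topologicalType).
HB.instance Definition _ := Topological.on ospace.
Local Notation V := ospace.
Implicit Types (x y z p : V).

Lemma coord_continuous b : continuous (fun x : V => (x : W -> R) b).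
Proof. exact: (@proj_continuous W (fun _ : W => R : topologicalType) b). Qed.

Lemma coord_near b x (e : R) : 0 < e -> nbhs x [set y : V | `|y b - x b| < e].
Proof.
move=> e0; have /cvgrPdist_lt /(_ e e0) := @coord_continuous b x.
by apply: filterS => y /=; rewrite distrC.
Qed.

Lemma ospace_hausdorff : hausdorff_space V.
Proof.
apply: (@hausdorff_product W (fun _ : W => R : topologicalType)) => _.
exact: norm_hausdorff.
Qed.

Definition cube : set V := [set x | forall b, 0 <= x b <= 1].

Lemma cube_compact : compact cube.
Proof.
have := @tychonoff W (fun _ : W => R : topologicalType) (fun=> `[0, 1]%classic)
  (fun=> @segment_compact R 0 1).
by congr compact; apply/seteqP; split=> x h b; have := h b; rewrite /= in_itv.
Qed.

Lemma closed_sub_cube (E : set V) : closed E -> E `<=` cube -> compact E.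
Proof. by move=> cE; apply: (subclosed_compact cE cube_compact). Qed.

Lemma compact_approx (E : set V) (P : set W) x : compact E ->
  (forall (F : seq W) (e : R), 0 < e ->
    exists2 y, E y & forall b, b \in F -> P b -> `|y b - x b| < e) ->
  exists2 y, E y & forall b, P b -> y b = x b.
Proof.
move=> cE h; have [|b k e e0||y Ey yx] := @compact_common_zero R V W E P (fun b y => y b - x b).
- exact: cE.
- have := @coord_near b k e e0; apply: filterS => y /=.
  by rewrite opprB addrA subrK.
- by move=> F e /(h F).
by exists y => // b Pb; apply/eqP; rewrite -subr_eq0 yx.
Qed.

Lemma compact_approx2 (A B : set V) (P : set W) : compact A -> compact B ->
  (forall (F : seq W) (e : R), 0 < e ->
    exists y z, [/\ A y, B z & forall b, b \in F -> P b -> `|y b - z b| < e]) ->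
  exists y z, [/\ A y, B z & forall b, P b -> y b = z b].
Proof.
move=> cA cB h.
have [|b [y z] e e0||[y z] [Ay Bz] yz] := @compact_common_zero R (V * V)%type W (A `*` B) P
   (fun b u => u.1 b - u.2 b).
- exact: compact_setX.
- have e20 : 0 < e / 2 by rewrite divr_gt0.
  exists ([set y' : V | `|y' b - y b| < e / 2], [set z' : V | `|z' b - z b| < e / 2]).
    by split; exact: coord_near.
  move=> [y' z'] /= [h1 h2].
  have -> : y' b - z' b - (y b - z b) = (y' b - y b) - (z' b - z b) by ring.
  by rewrite [ltRHS](splitr e); apply: (le_lt_trans (ler_normB _ _)); rewrite ltrD.
- by move=> F e /(h F)[y [z [Ay Bz yz]]]; exists (y, z).
by exists y, z; split=> // b Pb; apply/eqP; rewrite -subr_eq0 [_ - _]yz.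
Qed.

Lemma closed_coord_le b (u v : R) : closed [set x : V | u <= x b <= v].
Proof.
have -> : [set x : V | u <= x b <= v] = (fun x : V => (x : W -> R) b) @^-1` `[u, v].
  by apply/seteqP; split=> x /=; rewrite in_itv.
by apply: preimage_closed; [move=> x _; exact: coord_continuous|exact: interval_closed].
Qed.

Lemma closed_coord_eq b (u : R) : closed [set x : V | x b = u].
Proof.
have -> : [set x : V | x b = u] = [set x : V | u <= x b <= u].
  apply/seteqP; split=> x /=; first by move=> ->; rewrite lexx.
  by move=> h; apply/esym/le_anti.
exact: closed_coord_le.
Qed.

Lemma closed_agree a p : closed [set x : V | agree a x p].
Proof.
have -> : [set x : V | agree a x p] = \bigcap_(b in [set b | lt b a]) [set x : V | x b = p b].
  by apply/seteqP; split=> x h b; exact: h.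
by apply: closed_bigI => b _; exact: closed_coord_eq.
Qed.

Lemma closed_cube : closed cube.
Proof.
have -> : cube = \bigcap_(b in [set: W]) [set x : V | 0 <= x b <= 1].
  by apply/seteqP; split=> x h b; [move=> _|]; exact: h.
by apply: closed_bigI => b _; exact: closed_coord_le.
Qed.


(** [rho a] is the supremum metric of the product of the countably many coordinates below [a], the
    [n]-th of them truncated at 1/(n+1). The extra value 0 keeps the supremum over a nonempty set
    when [a] is the bottom. *)
Definition rho_term a p x b : R := Num.min (idx1 a b).+1%:R^-1 `|x b - p b|.
Definition rho a p x : R :=
  sup [set r | r = 0 \/ exists2 b, lt b a & r = rho_term a p x b].

Lemma rho_has_sup a p x :
  has_sup [set r | r = 0 \/ exists2 b, lt b a & r = rho_term a p x b].
Proof.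
split; first by exists 0; left.
exists 1 => _ [->|[b _ ->]] //; rewrite /rho_term ge_min invf_le1 ?ltr0n //.
by rewrite ler1n.
Qed.

Lemma rho_ge0 a p x : 0 <= rho a p x.
Proof. by apply: ub_le_sup; [case: (rho_has_sup a p x)|left]. Qed.

Lemma rho_term_le a p x b : lt b a -> rho_term a p x b <= rho a p x.
Proof.
by move=> ba; apply: ub_le_sup; [case: (rho_has_sup a p x)|right; exists b].
Qed.

Lemma rho_le a p x (r : R) : 0 <= r ->
  (forall b, lt b a -> rho_term a p x b <= r) -> rho a p x <= r.
Proof.
move=> r0 h; apply: ge_sup; first by exists 0; left.
by move=> _ [->|[b ba ->]] //; exact: h.
Qed.

Lemma rho_agree a p x : agree a x p -> rho a p x = 0.
Proof.
move=> xp; apply/le_anti; rewrite rho_ge0 andbT; apply: rho_le => // b ba.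
by rewrite /rho_term (xp b ba) subrr normr0 ge_min lexx orbT.
Qed.

Lemma rho_gt0 a p x : ~ agree a x p -> 0 < rho a p x.
Proof.
move=> /existsNP[b /not_implyP[ba ne]].
apply: lt_le_trans (rho_term_le p x ba).
by rewrite /rho_term lt_min invr_gt0 ltr0n normr_gt0 subr_eq0; apply/eqP.
Qed.

Lemma rho_depends a p : depends a (rho a p).
Proof.
move=> x y xy; congr sup; apply/seteqP; split=> r /= [->|[b ba ->]].
- by left.
- by right; exists b; rewrite // /rho_term xy.
- by left.
- by right; exists b; rewrite // /rho_term xy.
Qed.

(** Coordinates of index at least [1/r] contribute at most [r], so finitely many coordinates matter,
    the same ones for every [p]. *)
Lemma rho_unif a (r : R) : 0 < r -> exists F : seq W, forall p x y,
  (forall b, b \in F -> lt b a -> `|y b - x b| < r) ->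
  `|rho a p y - rho a p x| <= r.
Proof.
move=> r0; pose N := Num.bound r^-1.
have Nr n : (N <= n)%N -> n.+1%:R^-1 <= r.
  move=> Nn; rewrite -[leRHS]invrK lef_pV2 ?posrE ?invr_gt0 ?ltr0n //.
  apply: ltW; apply: lt_le_trans (archi_boundP _) _; first by rewrite invr_ge0 ltW.
  by rewrite ler_nat ltnW.
exists [seq xget (bot1 W) [set b | lt b a /\ idx1 a b = n] | n <- iota 0 N] => p.
suff H x y : (forall b, b \in [seq xget (bot1 W) [set b | lt b a /\ idx1 a b = n]
    | n <- iota 0 N] -> lt b a -> `|y b - x b| < r) -> rho a p y <= rho a p x + r.
  move=> x y h; rewrite ler_norml lerBlDl H // andbT lerBrDl.
  have := H y x; rewrite -lerBlDr; apply => b bF ba.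
  by rewrite distrC; exact: h.
move=> h; apply: rho_le => [|b ba]; first by rewrite addr_ge0 ?rho_ge0 ?ltW.
have := rho_term_le p x ba; rewrite -(lerD2r r); apply: le_trans.
have [Nb|bN] := leqP N (idx1 a b).
  apply: (@le_trans _ _ r); first by rewrite ge_min Nr.
  by rewrite lerDr /rho_term le_min invr_ge0 ler0n normr_ge0.
have bF : `|y b - x b| < r.
  apply: h => //; apply/mapP; exists (idx1 a b); first by rewrite mem_iota.
  set X := [set _ | _]; have [|xa xe] := @xgetPex _ (bot1 W) X; first by exists b.
  by symmetry; apply: idx1_inj xe; exact: lt1_le.
rewrite /rho_term -lerBlDr le_min !lerBlDr !ge_min; apply/andP; split; apply/orP; [left|right].
  by rewrite lerDl ltW.
have -> : y b - p b = (x b - p b) + (y b - x b) by ring.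
by apply: le_trans (ler_normD _ _) _; rewrite lerD2l ltW.
Qed.

Lemma rho_near a p x (r : R) : 0 < r ->
  nbhs x [set y : V | `|rho a p y - rho a p x| <= r].
Proof.
move=> r0; have [F FP] := rho_unif a r0.
have : \forall y \near nbhs x, forall b, b \in F -> `|(y : V) b - x b| < r.
  elim: F {FP} => [|b F ih]; first by apply: nearW.
  apply: filterS2 (ih) (coord_near b x r0) => y /= h1 h2 c.
  by rewrite inE => /orP[/eqP->|/h1].
by apply: filterS => y h; apply: FP => b bF _; exact: h.
Qed.

Lemma rho_small a (F : seq W) (e : R) : 0 < e -> exists2 r, 0 < r &
  forall p x, rho a p x < r -> forall b, b \in F -> lt b a -> `|x b - p b| < e.
Proof.
move=> e0.
have [r [r0 re rF]] : exists r : R, [/\ 0 < r, r <= e &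
    forall b, b \in F -> r <= (idx1 a b).+1%:R^-1].
  elim: F => [|c F [r [r0 re rF]]]; first by exists e.
  exists (Num.min r (idx1 a c).+1%:R^-1); split.
  - by rewrite lt_min r0 invr_gt0 ltr0n.
  - by rewrite ge_min re.
  - by move=> b; rewrite inE ge_min => /orP[/eqP->|/rF->]; rewrite ?lexx ?orbT.
exists r => // p x rx b bF ba.
have := le_lt_trans (rho_term_le p x ba) rx.
rewrite /rho_term gt_min => /orP[|h].
  by move=> /lt_le_trans /(_ (rF b bF)); rewrite ltxx.
exact: lt_le_trans h re.
Qed.

End Coordinates.

(** * Functions that oscillate near a point *)

Lemma lipschitz1_continuous (R : realType) (f : R -> R) :
  (forall x y, f x <= f y + `|x - y|) -> continuous f.
Proof.
move=> h x; apply/cvgrPdist_lt => e e0.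
have nx : \forall y \near nbhs x, `|x - y| < e by exact: (@nbhsx_ballx R R x e).
apply: filterS nx => y; apply: le_lt_trans.
have := h x y; have := h y x; rewrite (distrC y) ler_norml => h1 h2.
by apply/andP; split; lra.
Qed.

(** A sum of tents of radius 1 around the nodes [s k], with heights [t k]. The nodes are at least 2
    apart, so each tent vanishes at the other nodes, and [s k] is at least [k], so the sum is
    locally finite. *)
Lemma interpolation (R : realType) (s t : nat -> R) :
  0 <= s 0%N -> (forall k, s k + 2 <= s k.+1) ->
  exists2 psi : R -> R, continuous psi & forall k, psi (s k) = t k.
Proof.
move=> s0 ss.
have smono k m : (k <= m)%N -> s k + (m - k)%:R <= s m.
  elim: m => [|m ih]; first by rewrite leqn0 => /eqP->; rewrite subnn addr0.
  rewrite leq_eqVlt => /orP[/eqP->|]; first by rewrite subnn addr0.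
  rewrite ltnS => km; rewrite subSn // -natr1; have := ih km; have := ss m; lra.
have sgek k : k%:R <= s k by have := smono 0%N k (leq0n k); rewrite subn0; lra.
pose u k x := t k * Num.max 0 (1 - `|x - s k|).
pose f n x := \sum_(0 <= k < n) u k x.
have uc k : continuous (u k).
  suff tc : continuous (fun x : R => Num.max 0 (1 - `|x - s k|)).
    by move=> x; apply: cvgM; [exact: cvg_cst|exact: tc].
  apply: lipschitz1_continuous => x y.
  have := ler_normD (y - x) (x - s k); rewrite addrA subrK (distrC y x).
  have := normr_ge0 (x - y); set P := `|x - y|; set Q := `|x - _|; set S := `|y - _|.
  have : 0 <= Num.max 0 (1 - S) by rewrite le_max lexx.
  have : 1 - S <= Num.max 0 (1 - S) by rewrite le_max lexx orbT.
  by move=> h1 h2 h3 h4; rewrite ge_max; apply/andP; split; lra.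
have fc n : continuous (f n).
  elim: n => [|n ih] x.
    have -> : f 0%N = fun=> 0 by apply/funext => y; rewrite /f big_geq.
    exact: cvg_cst.
  have -> : f n.+1 = (f n \+ u n)%R by apply/funext => y; rewrite /f big_nat_recr.
  by apply: cvgD; [exact: ih|exact: uc].
have u0 k x : 1 <= `|x - s k| -> u k x = 0.
  by move=> h; rewrite /u max_l ?mulr0 // subr_le0.
have stab n m x : x + 1 <= n%:R -> (n <= m)%N -> f m x = f n x.
  move=> xn nm; rewrite /f (big_cat_nat (leq0n n) nm) /=.
  suff -> : \sum_(n <= k < m) u k x = 0 by rewrite addr0.
  rewrite big_nat_cond big1 // => k /andP[/andP[nk _] _]; apply: u0; have := sgek k.
  have : (n%:R : R) <= k%:R by rewrite ler_nat.
  by move=> h1 h2; rewrite ler_normr; apply/orP; right; lra.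
(* From index [N x] on all tents vanish at [x]. *)
pose N (x : R) := Num.bound (`|x| + 1).
have NP x : x + 1 <= (N x)%:R.
  apply: le_trans (ltW (archi_boundP _)); last by rewrite addr_ge0.
  by rewrite lerD2r ler_norm.
pose psi x := f (N x) x.
have psiE n x : x + 1 <= n%:R -> psi x = f n x.
  move=> xn; case: (leqP n (N x)) => [h|/ltnW h]; first exact: stab.
  by rewrite /psi (stab (N x) n).
exists psi.
  move=> x; pose M := Num.bound (`|x| + 2).
  have MP y : `|x - y| < 1 -> y + 1 <= M%:R.
    move=> xy; apply: le_trans (ltW (archi_boundP _)); last by rewrite addr_ge0.
    have := ler_norm x; have := ler_norm (y - x); rewrite distrC; lra.
  apply/cvgrPdist_lt => e e0.
  have /cvgrPdist_lt /(_ e e0) := fc M x.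
  have nx : \forall y \near nbhs x, `|x - y| < 1.
    by apply: (@nbhsx_ballx R R x 1); exact: ltr01.
  apply: filterS2 nx => y /= xy; rewrite !(psiE M) //; apply: MP => //.
  by rewrite subrr normr0.
move=> k; have [n n1 n2] : exists2 n, s k + 1 <= n%:R & (k < n)%N.
  exists (maxn (N (s k)) k.+1); last by rewrite leq_max leqnn orbT.
  by apply: le_trans (NP _) _; rewrite ler_nat leq_maxl.
rewrite (psiE n) // /f big_mkord (bigD1 (Ordinal n2)) //= big1 ?addr0.
  by rewrite /u subrr normr0 subr0 max_r ?ler01 // mulr1.
move=> [i /= ilt] /eqP ne; apply: u0.
have : i <> k by move=> e; apply: ne; apply: val_inj.
move=> /eqP; rewrite neq_ltn ler_normr => /orP[] ik; apply/orP; [left|right].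
  have := smono _ _ (ltnW ik); have : (1 : R) <= (k - i)%:R by rewrite ler1n subn_gt0.
  lra.
have := smono _ _ (ltnW ik); have : (1 : R) <= (i - k)%:R by rewrite ler1n subn_gt0.
lra.
Qed.

Section Oscillation.
Variables (W : omega_one) (R : realType).
Implicit Types (a b : W).
Local Notation lt := (@lt1 W).
Local Notation V := (ospace W R).
Implicit Types (x y z p : V) (F : seq W).

Definition close a F (e : R) x y := forall b, b \in F -> lt b a -> `|x b - y b| < e.

Definition limit_at a p (E : set V) := forall F (e : R), 0 < e ->
  exists z, [/\ E z, ~ agree a z p & close a F e z p].

(** A sequence [zs] approaches [p] with reciprocal distances growing by at least 2 at each step. [h]
    is a continuous function of the reciprocal distance, clamped to the unit interval, that
    interpolates prescribed values at these nodes. The sequence visits every [E n] arbitrarily near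
    [p] with every rational value prescribed. *)
Lemma oscillating a p (E : nat -> set V) : (forall n, limit_at a p (E n)) ->
  exists h : V -> R, [/\ depends a h, forall x, 0 <= h x <= 1,
    closed [set x : V | x a = h x \/ agree a x p] &
    forall n t F (e : R), 0 <= t <= 1 -> 0 < e ->
      exists z, [/\ E n z, ~ agree a z p, close a F e z p & `|h z - t| < e]].
Proof.
move=> lim.
(* Task [k] is a triple: the index of the set to visit, the value to be taken there, and a lower
   bound on the reciprocal distance to [p]. *)
pose dec k : nat * rat * nat := odflt (0%N, 0, 0%N) (unpickle k).
pose good k (s : R) := [set z : V | [/\ E (dec k).1.1 z, ~ agree a z p,
   s + 2 <= (rho a p z)^-1 & (dec k).2%:R <= (rho a p z)^-1]].
have goodP k s : good k s (xget (p : {classic V}) (good k s)).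
  apply: (@xgetPex {classic V}).
  pose m : R := Num.max (`|s| + 2) ((dec k).2%:R + 1).
  have m0 : 0 < m by rewrite lt_max; apply/orP; right; rewrite ltr_wpDl.
  have [F FP] := @rho_unif W R a _ (divr_gt0 ltr01 m0).
  have [z [Ez nz zp]] := lim (dec k).1.1 F _ (divr_gt0 ltr01 m0).
  have r0 := rho_gt0 nz.
  have rm : m <= (rho a p z)^-1.
    rewrite -[leLHS]invrK lef_pV2 ?posrE ?invr_gt0 //.
    have := FP p p z zp; rewrite (rho_agree (@agree_refl W R a p)) subr0 div1r.
    by rewrite ger0_norm // ltW.
  exists z; split=> //; apply: le_trans rm; rewrite le_max.
    by apply/orP; left; rewrite lerD2r ler_norm.
  by apply/orP; right; lra.
pose zs := fix zs k : V := if k is m.+1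
  then xget (p : {classic V}) (good k (rho a p (zs m))^-1)
  else xget (p : {classic V}) (good k 0).
pose s k := (rho a p (zs k))^-1.
pose t k : R := ratr (dec k).1.2.
have zsP k : [/\ E (dec k).1.1 (zs k), ~ agree a (zs k) p & (dec k).2%:R <= s k].
  by case: k => [|k]; [case: (goodP 0%N 0)|case: (goodP k.+1 (s k))].
have [||psi psic psiE] := @interpolation R s t.
- by rewrite invr_ge0 rho_ge0.
- by move=> k; case: (goodP k.+1 (s k)).
pose cl (r : R) : R := Num.max 0 (Num.min 1 r).
have clc : continuous cl.
  apply: lipschitz1_continuous => r r'.
  have := normr_ge0 (r - r'); have := ler_norm (r - r'); set P := `|_| => h1 h2.
  have : 0 <= cl r' by rewrite le_max lexx.
  have : Num.min 1 r' <= cl r' by rewrite le_max lexx orbT.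
  have : Num.min 1 r <= Num.min 1 r' + P.
    by rewrite -lerBlDr le_min !lerBlDr !ge_min; apply/andP; split; apply/orP; [left|right]; lra.
  by move=> h3 h4 h5; rewrite {1}/cl ge_max; apply/andP; split; lra.
have cl01 r : 0 <= cl r <= 1.
  by rewrite le_max lexx /= ge_max ler01 ge_min lexx.
have clE r : 0 <= r <= 1 -> cl r = r.
  by move=> /andP[r0 r1]; rewrite /cl min_r // max_r.
pose h (x : V) : R := cl (psi (rho a p x)^-1).
have hc x (e : R) : ~ agree a x p -> 0 < e -> nbhs x [set y : V | `|h x - h y| < e].
  move=> /rho_gt0 r0 e0.
  have gc : {for rho a p x, continuous (fun r : R => cl (psi r^-1))}.
    apply: (@cvg_comp _ _ _ GRing.inv (cl \o psi)).
      by apply: inv_continuous; rewrite gt_eqF.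
    by apply: cvg_comp; [exact: psic|exact: clc].
  move/cvgrPdist_lt : gc => /(_ e e0) /nbhs_ballP[d /= d0 dP].
  have := @rho_near W R a p x _ (divr_gt0 d0 (ltr0n R 2)).
  apply: filterS => y /= ry; apply: dP; rewrite /ball /= distrC.
  by apply: le_lt_trans ry _; lra.
exists h; split=> //.
- by move=> x y xy; rewrite /h (@rho_depends W R a p x y xy).
- by move=> x; exact: cl01.
(* The complement is open: off the fibre of [p] the function [h] is continuous, and by [rho_near]
   nearby points stay off that fibre. *)
- rewrite -[X in closed X]setCK; apply: open_closedC; rewrite openE => x /= /not_orP[/eqP xh nx]; rewrite /interior /=.
  have d0 : 0 < `|x a - h x| by rewrite normr_gt0 subr_eq0.
  have d40 : 0 < `|x a - h x| / 2 by rewrite divr_gt0.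
  have np : nbhs x [set y : V | `|rho a p y - rho a p x| <= rho a p x / 2].
    by apply: rho_near; rewrite divr_gt0 // rho_gt0.
  have r0 := rho_gt0 nx.
  near=> y; move=> /= [yh|yp].
    have : `|h x - h y| < `|x a - h x| / 2 by near: y; exact: hc.
    have : `|y a - x a| < `|x a - h x| / 2 by near: y; exact: coord_near.
    rewrite yh => h1 h2; have := ltrD h1 h2.
    rewrite -splitr => h3.
    have := ler_normD (h y - x a) (h x - h y).
    have -> : h y - x a + (h x - h y) = - (x a - h x) by ring.
    by rewrite normrN => /le_lt_trans /(_ h3); rewrite ltxx.
  have : `|rho a p y - rho a p x| <= rho a p x / 2 by near: y.
  rewrite (rho_agree yp) sub0r normrN gtr0_norm //; lra.
- move=> n t0 F e /andP[t00 t01] e0.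
  have [r r0 rP] := @rho_small W R a F e e0.
  have [q qt] : exists q : rat, `|cl (ratr q) - t0| < e.
    have : \forall y \near nbhs t0, `|cl t0 - cl y| < e.
      by have /cvgrPdist_lt /(_ e e0) := clc t0.
    rewrite clE ?t00 // => /nbhs_ballP[d /= d0 dP].
    have [q] := @rat_in_itvoo R t0 (t0 + d) ltac:(lra).
    rewrite in_itv /= => /andP[q1 q2]; exists q; rewrite distrC; apply: dP.
    rewrite /ball /= distrC ger0_norm; lra.
  pose j := Num.bound r^-1.
  have dj : dec (pickle (n, q, j)) = (n, q, j) by rewrite /dec pickleK.
  have := zsP (pickle (n, q, j)); set k := pickle _; rewrite -/k in dj *.
  rewrite dj /= => -[Ez nz js].
  exists (zs k); split=> //; last by rewrite /h -/(s k) psiE /t dj.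
  apply: rP; have rz := rho_gt0 nz.
  rewrite -ltf_pV2 ?posrE //; apply: lt_le_trans js.
  by apply: archi_boundP; rewrite invr_ge0 ltW.
Unshelve. all: by end_near.
Qed.

End Oscillation.

(** * Systems of splittings *)

Section Systems.
Variables (W : omega_one) (R : realType).
Implicit Types (a b c g m : W).
Local Notation lt := (@lt1 W).
Local Notation le a b := (~ lt1 b a).
Local Notation V := (ospace W R).
Implicit Types (x y z p : V) (F : seq W) (A B E : set V).

Lemma seq_bounded (P : set W) F :
  (forall c, c \in F -> ~ P c) \/
  exists2 m, P m & forall c, c \in F -> P c -> le c m.
Proof.
elim: F => [|d F ih]; first by left.
have [Pd|nd] := EM (P d); last first.
  case: ih => [h|[m Pm mF]].
    by left => c; rewrite inE => /orP[/eqP->|/h].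
  by right; exists m => // c; rewrite inE => /orP[/eqP->//|/mF].
right; case: ih => [h|[m Pm mF]].
  exists d => // c; rewrite inE => /orP[/eqP-> _|/h//]; exact: lt1_irr.
have [dm|md] := EM (lt d m).
  exists m => // c; rewrite inE => /orP[/eqP-> _|/mF//]; exact: lt1_le.
exists d => // c; rewrite inE => /orP[/eqP-> _|/mF h Pc]; first exact: lt1_irr.
by apply: le1_trans md; exact: h.
Qed.

Definition agree_le1 b x y := forall c, le c b -> x c = y c.

Lemma agree_le1P b x y : agree b x y -> x b = y b -> agree_le1 b x y.
Proof. by move=> xy e c /le1P[->//|]; exact: xy. Qed.

(** The limit step of inductions on coordinates: those members of a finite set that lie in [P] have
    a largest one, and agreement up to it covers them all; compactness does the rest. *)
Lemma compact_glue2 A B (P : set W) : compact A -> compact B ->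
  A !=set0 -> B !=set0 ->
  (forall m, P m -> exists x y, [/\ A x, B y & agree_le1 m x y]) ->
  exists x y, [/\ A x, B y & forall c, P c -> x c = y c].
Proof.
move=> cA cB [x0 Ax0] [y0 By0] h; apply: compact_approx2 => // F e e0.
have [hF|[m Pm mF]] := seq_bounded P F.
  by exists x0, y0; split=> // c /hF.
have [x [y [Ax By xy]]] := h m Pm.
exists x, y; split=> // c cF Pc.
by rewrite (xy c) ?subrr ?normr0 //; exact: mF.
Qed.

Lemma compact_glue E (P : set W) x : compact E -> E !=set0 ->
  (forall m, P m -> exists2 y, E y & agree_le1 m y x) ->
  exists2 y, E y & forall c, P c -> y c = x c.
Proof.
move=> cE [y0 Ey0] h; apply: compact_approx => // F e e0.
have [hF|[m Pm mF]] := seq_bounded P F.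
  by exists y0 => // c /hF.
have [y Ey xy] := h m Pm.
exists y => // c cF Pc.
by rewrite (xy c) ?subrr ?normr0 //; exact: mF.
Qed.

Definition datum := (set V * (V -> R))%type.
Implicit Types (D : W -> datum) (d : datum).

Definition constr b d x := x b = d.2 x \/ d.1 x.

Definition good_at b d := [/\ depends b d.1, depends b d.2,
  forall x, 0 <= d.2 x <= 1 & closed [set x | constr b d x]].

(* [(D b).1] consists of the points that are split at stage [b]: above them the
   coordinate [b] ranges over the whole interval, elsewhere it is [(D b).2]. *)
Definition space D : set V := [set x | cube x /\ forall b, constr b (D b) x].

Lemma constr_agree b d x y : good_at b d -> agree b x y -> x b = y b ->
  constr b d x -> constr b d y.
Proof.
move=> [d1 d2 _ _] xy e [h|h]; [left|right].
  by rewrite -e h; exact: d2.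
by rewrite -(d1 _ _ xy).
Qed.

Lemma closed_space D : (forall b, good_at b (D b)) -> closed (space D).
Proof.
move=> gD; apply: closedI; first exact: closed_cube.
have -> : (fun x => forall b, constr b (D b) x) =
    \bigcap_(b in [set: W]) [set x | constr b (D b) x].
  by apply/seteqP; split=> x h b; [move=> _|]; exact: h.
by apply: closed_bigI => b _; case: (gD b).
Qed.

Lemma compact_space D : (forall b, good_at b (D b)) -> compact (space D).
Proof. by move=> gD; apply: closed_sub_cube (closed_space gD) _ => x []. Qed.

(** The values of [y] are kept below [a], and at [a] if [y] is split there; the remaining
    coordinates follow from [(D b).2] by recursion. *)
Lemma space_extend D a y : (forall b, good_at b (D b)) -> cube y ->
  (forall b, lt b a -> constr b (D b) y) ->
  exists x, [/\ space D x, agree a x y & (D a).1 y -> x a = y a].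
Proof.
move=> gD cy hy.
have [x xP] := wf_rec 0 (fun b (prev : W -> R) =>
  if `[< lt b a \/ (b = a /\ (D a).1 y) >] then y b else (D b).2 prev).
have xlow : agree a x y by move=> b ba; rewrite xP; case: asboolP => // n; case: n; left.
have xa : (D a).1 y -> x a = y a.
  by move=> Sy; rewrite xP; case: asboolP => // n; case: n; right.
exists x; split=> //.
have prevE b : (D b).2 (fun c => if `[< lt c b >] then x c else 0) = (D b).2 x.
  by have [_ + _ _] := gD b; apply=> c cb; case: asboolP.
split=> b.
  rewrite xP; case: asboolP => _; first exact: cy.
  by rewrite prevE; case: (gD b).
have [ba|nba] := EM (lt b a).
  apply: constr_agree (hy b ba) => //.
    by apply: agree_sym; exact: agree_lt xlow.
  by rewrite xlow.
have [[-> Sy]|n] := EM (b = a /\ (D a).1 y).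
  by right; have [d1 _ _ _] := gD a; rewrite (d1 x y).
left; rewrite {1}xP; case: asboolP => [[//|//]|_]; exact: prevE.
Qed.

Lemma space_extend_at D a y (t : R) : (forall b, good_at b (D b)) -> cube y ->
  (forall b, lt b a -> constr b (D b) y) -> (D a).1 y -> 0 <= t <= 1 ->
  exists x, [/\ space D x, agree a x y & x a = t].
Proof.
move=> gD cy hy Sy t01.
pose y' : V := fun b => if b == a then t else y b.
have y'y : agree a y' y.
  by move=> b ba; rewrite /y'; case: eqP => // e; subst b; case: (lt1_irr ba).
have [|b ba|x [sx xy' xa]] := @space_extend D a y' gD.
- by move=> b; rewrite /y'; case: eqP => // _; exact: cy.
- apply: constr_agree (hy b ba) => //; last by rewrite y'y.
  by apply: agree_sym; exact: agree_lt y'y.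
- exists x; split=> //; first exact: agree_trans xy' y'y.
  rewrite xa /y' ?eqxx //; have [d1 _ _ _] := gD a.
  by rewrite -/y' (d1 _ y).
Qed.

(** A coordinate at which the point is not split is a function of the earlier ones. *)
Lemma unsplit_agree D a c x y : (forall b, lt b c -> good_at b (D b)) ->
  (forall b, lt b c -> constr b (D b) x) -> (forall b, lt b c -> constr b (D b) y) ->
  agree a x y -> (forall b, le a b -> lt b c -> ~ (D b).1 x) -> agree c x y.
Proof.
move=> gD hx hy xy ns b; elim/(well_founded_ind (@lt1_wf W)): b => b ih bc.
have [/xy//|ab] := EM (lt b a).
have bxy : agree b x y by move=> b' b'b; apply: ih => //; exact: lt1_trans bc.
have [d1 d2 _ _] := gD b bc.
have nx := ns b ab bc.
have ny : ~ (D b).1 y by rewrite -(d1 _ _ bxy).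
have [->|//] := hx b bc; have [->|//] := hy b bc; exact: d2.
Qed.

Lemma connected_segment : connected `[0, 1 : R]%classic.
Proof. exact: segment_connected. Qed.

(* The least [b] such that [A] and [B] already have disjoint projections to the
   coordinates up to [b] would disconnect a fibre of stage [b], i.e. a segment. *)
Lemma fiber_connected D g y0 A B : (forall b, good_at b (D b)) ->
  closed A -> closed B -> A !=set0 -> B !=set0 ->
  A `|` B = [set x | space D x /\ agree g x y0] -> A `&` B !=set0.
Proof.
move=> gD clA clB A0 B0 AB.
have inA x : A x -> space D x /\ agree g x y0.
  by move=> Ax; have : (A `|` B) x by [left]; rewrite AB.
have inB x : B x -> space D x /\ agree g x y0.
  by move=> Bx; have : (A `|` B) x by [right]; rewrite AB.
have cA : compact A by apply: closed_sub_cube => // x /inA[[]].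
have cB : compact B by apply: closed_sub_cube => // x /inB[[]].
suff H b : exists x y, [/\ A x, B y & agree_le1 b x y].
  have [|x [y [Ax By xy]]] := @compact_glue2 A B setT cA cB A0 B0.
    by move=> m _; exact: H.
  exists x; split=> //; suff -> : x = y by [].
  by apply/funext => c; exact: xy.
elim/(well_founded_ind (@lt1_wf W)): b => b ih.
have [x [y [Ax By xy]]] := compact_glue2 cA cB A0 B0 ih.
have [bg|gb] := EM (lt b g).
  exists x, y; split=> // c cb.
  have [_ xy0] := inA x Ax; have [_ yy0] := inB y By.
  by rewrite xy0 ?yy0 //; exact: le1_lt_trans bg.
have [[cx sx] xg] := inA x Ax; have [[cy sy] yg] := inB y By.
have [d1 d2 _ _] := gD b.
have [Sx|nx] := EM ((D b).1 x); last first.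
  have ny : ~ (D b).1 y by rewrite -(d1 _ _ xy).
  exists x, y; split=> //; apply: agree_le1P => //.
  by have [->|//] := sx b; have [->|//] := sy b; exact: d2.
(* The values at [b] of the points of [E] that agree with [x] below [b]. For [A] and [B] these are
   nonempty closed sets, covering the segment by [space_extend_at], so they must meet. *)
pose T E : set R := (fun z : V => z b) @` (E `&` [set z : V | agree b z x]).
have Tcl E : compact E -> closed (T E).
  move=> cE; apply: compact_closed; first exact: norm_hausdorff.
  apply: continuous_compact.
    by apply: continuous_subspaceT; exact: coord_continuous.
  apply: compact_closedI => //; exact: closed_agree.
have T01 E : E `<=` A `|` B -> T E `<=` `[0, 1]%classic.
  move=> EAB _ [z [Ez _] <-]; rewrite /= in_itv.
  by have := EAB z Ez; rewrite AB => -[[cz _] _]; exact: cz.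
have TAB t : `[0, 1]%classic t -> T A t \/ T B t.
  rewrite /= in_itv /= => t01.
  have [z [sz zx zt]] := @space_extend_at D b x t gD cx (fun c _ => sx c) Sx t01.
  have : (A `|` B) z.
    rewrite AB; split=> //; apply: agree_trans xg.
    exact: agree_le zx.
  by move=> [Az|Bz]; [left|right]; exists z.
have TA0 : T A !=set0 by exists (x b), x.
have [t TBt] : T B !=set0.
  by exists (y b), y => //; split=> //; exact: agree_sym.
apply: contrapT => nex.
have dis u : T A u -> T B u -> False.
  move=> [x1 [Ax1 x1x] x1u] [y1 [By1 y1x] y1u]; apply: nex.
  exists x1, y1; split=> //; apply: agree_le1P; last by rewrite x1u y1u.
  by apply: agree_trans x1x _; exact: agree_sym.
suff TAE : T A = `[0, 1]%classic.
  by apply: (dis t) => //; rewrite TAE; apply: (T01 B) => // z; right.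
apply: connected_segment => //.
- exists (~` T B); first by apply: closed_openC; exact: Tcl.
  apply/seteqP; split=> u.
    by move=> TAu; split; [apply: (T01 A _ u TAu) => z; left|move=> TBu; exact: (dis u)].
  by move=> [/TAB[//|]].
- exists (T A); first exact: Tcl.
  by apply/esym/setIidPr; apply: T01 => z; left.
Qed.

Lemma open_close a F (e : R) p : open [set z : V | close a F e z p].
Proof.
rewrite openE => x xp; change (\forall z \near nbhs x, close a F e z p).
elim: F xp => [|b F ih] xp; first by apply: nearW => z b; rewrite in_nil.
have xF : close a F e x p by move=> c cF; apply: xp; rewrite inE cF orbT.
have nb : \forall z \near nbhs x, lt b a -> `|(z : V) b - p b| < e.
  have [ba|nba] := EM (lt b a); last by apply: nearW.
  have := xp b; rewrite inE eqxx => /(_ isT ba) xb.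
  have := @coord_near W R b x (e - `|x b - p b|); rewrite subr_gt0 => /(_ xb).
  apply: filterS => z /= h _; have := ler_distD (x b) (z b) (p b); lra.
apply: filterS2 nb (ih xF) => z /= h1 h2 c.
by rewrite inE => /orP[/eqP->|/h2].
Qed.

(** Otherwise the points that agree with [p] below [a] and the points far from [p] would be two
    disjoint closed sets covering the connected fibre. The second is nonempty, since the coordinate
    [g], which lies below [a], takes all values in the fibre. *)
Lemma fiber_limit D g a p : (forall b, good_at b (D b)) -> space D p ->
  (D g).1 p -> lt g a -> limit_at a p [set z | space D z /\ agree g z p].
Proof.
move=> gD sp Sp ga F e e0; apply: contrapT => nex.
pose Phi := [set z | space D z /\ agree g z p].
have clPhi : closed Phi by apply: closedI; [exact: closed_space|exact: closed_agree].
have far z : Phi z -> ~ agree a z p -> ~ close a F e z p.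
  by move=> Pz nz cz; apply: nex; exists z.
have pp : close a F e p p by move=> b _ _; rewrite subrr normr0.
have [|||||z] := @fiber_connected D g p (Phi `&` [set z : V | agree a z p])
    (Phi `&` ~` [set z : V | close a F e z p]) gD.
- by apply: closedI => //; exact: closed_agree.
- by apply: closedI => //; apply: open_closedC; exact: open_close.
- by exists p; split.
- have [t t01 tp] : exists2 t : R, 0 <= t <= 1 & t <> p g.
    have [e1|ne] := EM (p g = 0); [exists 1|exists 0]; rewrite ?ler01 ?lexx //.
    - by rewrite e1; apply/eqP; exact: oner_neq0.
    - by move=> h; apply: ne.
  have [cp hp] := sp.
  have [z [sz zp zt]] := @space_extend_at D g p t gD cp (fun b _ => hp b) Sp t01.
  have Pz : Phi z by [].
  exists z; split=> //=; apply: far => // zap; apply: tp.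
  by rewrite -zt; exact: zap.
- apply/seteqP; split=> z; first by move=> [[]|[]].
  move=> Pz; have [h|h] := EM (agree a z p); [left|right]; split=> //=.
  exact: far.
- move=> [[_ /= zp] [_ /= nz]]; apply: nz => b bF ba.
  by rewrite (zp b ba) subrr normr0.
Qed.

(** From stage [a] on every point counts as split, so only the coordinates below [a] are
    constrained. *)
Definition trunc a D b : datum := if `[< lt b a >] then D b else (setT, fun=> 0).

Lemma trunc_lt a D b : lt b a -> trunc a D b = D b.
Proof. by rewrite /trunc; case: asboolP. Qed.

Lemma trunc_good a D : (forall b, lt b a -> good_at b (D b)) ->
  forall b, good_at b (trunc a D b).
Proof.
move=> gD b; rewrite /trunc; case: asboolP => [/gD//|_].
split=> //= [x|]; first by rewrite lexx ler01.
have -> : [set x | constr b (setT, fun=> 0) x] = setT; last exact: closedT.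
by apply/seteqP; split=> // x _; right.
Qed.

Lemma space_trunc a D x : cube x -> space (trunc a D) x <->
  forall b, lt b a -> constr b (D b) x.
Proof.
move=> cx; split=> [[_ h] b ba|h].
  by have := h b; rewrite trunc_lt.
split=> // b; have [ba|nba] := EM (lt b a); first by rewrite trunc_lt //; exact: h.
by right; rewrite /trunc; case: asboolP.
Qed.

End Systems.

(** * The construction *)

(** A family of rational boxes, to be read in the coordinates below some [a] through [idx1 a]; it
    stands for the closed set of points outside all of them. *)
Definition code := set (seq (nat * (rat * rat))).

Lemma small_code : small code.
Proof. exact: small_set. Qed.

Section Codes.
Variables (W : omega_one) (R : realType).
Implicit Types (a b g mu : W).
Local Notation lt := (@lt1 W).
Local Notation le a b := (~ lt1 b a).
Local Notation V := (ospace W R).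
Implicit Types (x y z p : V) (F : seq W) (E : set V).

Definition in_box a (s : seq (nat * (rat * rat))) x := forall i, i \in s ->
  forall b, lt b a -> idx1 a b = i.1 -> ratr i.2.1 < x b < ratr i.2.2.

Lemma in_box_agree a s x y : agree a x y -> in_box a s x -> in_box a s y.
Proof. by move=> xy h i si b ba bi; rewrite -xy //; exact: h. Qed.

Lemma box_close a F (e : R) x : 0 < e -> exists s, in_box a s x /\
  forall y, in_box a s y -> close a F e y x.
Proof.
move=> e0.
have ratP (u v : R) : u < v -> exists q : rat, u < ratr q < v.
  by move=> uv; have [q] := rat_in_itvoo uv; rewrite in_itv; exists q.
have r1 b : x b - e < x b by rewrite ltrBlDr ltrDl.
have r2 b : x b < x b + e by rewrite ltrDl.
pose q1 b := sval (cid (ratP _ _ (r1 b))); have q1P b := svalP (cid (ratP _ _ (r1 b))).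
pose q2 b := sval (cid (ratP _ _ (r2 b))); have q2P b := svalP (cid (ratP _ _ (r2 b))).
exists [seq (idx1 a b, (q1 b, q2 b)) | b <- F & `[< lt b a >]]; split.
  move=> i /mapP[b]; rewrite mem_filter => /andP[/asboolP ba bF] -> c ca /= e1.
  have -> : c = b by apply: idx1_inj e1; exact: lt1_le.
  by have /andP[_ ->] := q1P b; have /andP[->] := q2P b.
move=> y yb b bF ba.
have /andP[h1 h2] := q1P b; have /andP[h3 h4] := q2P b.
have := yb (idx1 a b, (q1 b, q2 b)).
rewrite ltr_norml.
have -> : (idx1 a b, (q1 b, q2 b)) \in [seq (idx1 a b, (q1 b, q2 b)) | b <- F & `[< lt b a >]].
  by apply: map_f; rewrite mem_filter bF andbT; apply/asboolP.
move=> /(_ isT b ba erefl)/andP[/= h5 h6]; apply/andP; split; lra.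
Qed.

Lemma open_box a s : open [set x : V | in_box a s x].
Proof.
rewrite openE => x xp; change (\forall z \near nbhs x, in_box a s z).
elim: s xp => [|i s ih] xp; first by apply: nearW => z b; rewrite in_nil.
have xs : in_box a s x by move=> j js; apply: xp; rewrite inE js orbT.
have nb : \forall z \near nbhs x, forall b, lt b a -> idx1 a b = i.1 ->
    ratr i.2.1 < (z : V) b < ratr i.2.2.
  have [[b [ba bi]]|nex] := EM (exists b, lt b a /\ idx1 a b = i.1); last first.
    by apply: nearW => z b ba bi; exfalso; apply: nex; exists b.
  have := xp i; rewrite inE eqxx => /(_ isT b ba bi)/andP[x1 x2].
  have := @coord_near W R b x (x b - ratr i.2.1); rewrite subr_gt0 => /(_ x1).
  have := @coord_near W R b x (ratr i.2.2 - x b); rewrite subr_gt0 => /(_ x2).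
  apply: filterS2 => z /= + + c ca ci.
  have -> : c = b by apply: (@idx1_inj W a); [exact: lt1_le..|rewrite bi].
  rewrite !ltr_norml => /andP[h1 h2] /andP[h3 h4]; apply/andP; split; lra.
apply: filterS2 nb (ih xs) => z /= h1 h2 j.
by rewrite inE => /orP[/eqP->|]; [exact: h1|exact: h2].
Qed.

Definition coded a (c : code) : set V := [set x | forall s, c s -> ~ in_box a s x].

Lemma closed_coded a c : closed (coded a c).
Proof.
have -> : coded a c = \bigcap_(s in c) ~` [set x : V | in_box a s x].
  by apply/seteqP; split=> x h s; exact: h.
by apply: closed_bigI => s _; apply: open_closedC; exact: open_box.
Qed.

(** The code consists of all boxes that miss [E]; by compactness a point outside the projection of
    [E] lies in one of them. *)
Lemma codedP a E : compact E -> exists c,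
  forall x, coded a c x <-> exists2 y, E y & agree a x y.
Proof.
move=> cE; exists [set s | forall y, E y -> ~ in_box a s y] => x; split; last first.
  by move=> [y Ey xy] s /(_ y Ey) ny xs; apply: ny; exact: in_box_agree xs.
move=> cx; suff [y Ey yx] : exists2 y, E y & forall b, lt b a -> y b = x b.
  by exists y => //; exact: agree_sym.
apply: (@compact_approx W R E (fun b => lt b a) x cE) => F e e0.
have [s [xs sF]] := box_close a F x e0.
apply: contrapT => nex; apply: (cx s) => // y Ey /sF yx.
by apply: nex; exists y.
Qed.

(** Uncountability of the projection of [E] to the coordinates below [a]. *)
Definition unc a E := forall D : nat -> V, exists2 x, E x & forall n, ~ agree a x (D n).

End Codes.

(** * The recursion along omega_1 *)

Section Construction.
Variables (W : omega_one) (R : realType).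
Implicit Types (a b g dl mu : W).
Local Notation lt := (@lt1 W).
Local Notation le a b := (~ lt1 b a).
Local Notation V := (ospace W R).
Local Notation coded := (@coded W R).
Implicit Types (x y z p : V) (F : seq W) (E Q : set V).
Implicit Types (T : W -> datum W R) (d : datum W R).

(* [U mu x] means that [x] is not frozen at stage [mu]. *)
Variable U : W -> set V.
Hypothesis U_dep : forall mu, depends mu (U mu).
Hypothesis U_sel : forall dl a c (D : nat -> V), le dl a -> unc dl (coded a c) ->
  exists z, [/\ coded a c z, forall n, ~ agree dl z (D n) &
    forall mu, le dl mu -> le mu a -> U mu z].
Variable bk : W -> W * code.

(** Passes from coded sets to compact ones: [z] is replaced by a point of [E] with the same
    coordinates below [a], which the sets [U mu] with [mu] up to [a] cannot distinguish. *)
Lemma U_compact dl a E (D : nat -> V) : compact E -> le dl a -> unc dl E ->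
  exists z, [/\ E z, forall n, ~ agree dl z (D n) &
    forall mu, le dl mu -> le mu a -> U mu z].
Proof.
move=> cE da uE; have [c cP] := codedP a cE.
have [|z [/cP[y Ey zy] zD zU]] := U_sel (c := c) D da.
  move=> D'; have [x Ex xD] := uE D'; exists x => //.
  by apply/cP; exists x.
have ady : agree dl y z by apply: agree_sym; exact: agree_le zy.
exists y; split=> // [n yD|mu dmu mua]; first by apply: (zD n); exact: agree_trans (agree_sym ady) yD.
by rewrite -(U_dep (agree_le mua zy)); exact: zU.
Qed.

(** Up to countably many projections, the points of [Q] are unfrozen below [dl]. As [U_compact]
    takes care of the stages from [dl] to [a], a compact [Q] then has a point that is unfrozen at
    all stages above the bottom up to [a] and may be split. *)
Definition handleable dl Q := unc dl Q /\ exists C0 : nat -> V, forall x, Q x ->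
  (forall n, ~ agree dl x (C0 n)) -> forall mu, mu <> bot1 W -> lt mu dl -> U mu x.

(** [st_live] allows splits on unfrozen threads only, for first countability; [st_osc] asks for
    oscillation along every earlier fibre through a split point, [st_task] along the set handed over
    by [bk]. The points [z] of [st_task] are not split from [(bk a).1] to [a], so a subset of the
    final space known only by its projection below [(bk a).1] has points that agree with [z] below
    [a]. *)
Record stage a T d : Prop := Stage {
  st_good : good_at a d;
  st_bot : a = bot1 W -> d.1 = setT;
  st_class : forall x y, d.1 x -> d.1 y -> agree a x y;
  st_live : a <> bot1 W -> forall x mu, d.1 x -> mu <> bot1 W -> le mu a -> U mu x;
  st_osc : forall g x t F (e : R), lt g a -> space T x -> d.1 x -> (T g).1 x ->
    0 <= t <= 1 -> 0 < e -> exists z, [/\ space T z /\ (T g).1 z, ~ d.1 z,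
      close a F e z x & `|d.2 z - t| < e];
  st_task : le (bk a).1 a -> handleable (bk a).1 (coded (bk a).1 (bk a).2 `&` space T) ->
    exists p, [/\ space T p, d.1 p & forall t F (e : R), 0 <= t <= 1 -> 0 < e ->
      exists z, [/\ (coded (bk a).1 (bk a).2 `&` space T) z,
        forall mu, le (bk a).1 mu -> lt mu a -> ~ (T mu).1 z, ~ d.1 z,
        close a F e z p & `|d.2 z - t| < e]] }.

Lemma stage_ex a T : (forall b, good_at b (T b)) ->
  (forall g, lt g a -> forall x y, (T g).1 x -> (T g).1 y -> agree g x y) ->
  exists d, stage a T d.
Proof.
move=> gT clT.
have [a0|na0] := EM (a = bot1 W).
  exists (setT, fun=> 0); split=> //=.
  - split=> //= [x|]; first by rewrite lexx ler01.
    have -> : [set x : V | constr a (setT, fun=> 0) x] = setT; last exact: closedT.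
    by apply/seteqP; split=> // x _; right.
  - by move=> x y _ _ b; rewrite a0 => /bot1_min.
  - by move=> g x t F e; rewrite a0 => /bot1_min.
  (* There is no coordinate below the bottom, so no projection is uncountable and no task arises. *)
  - move=> da [+ _] => /(_ (fun=> 0))[x _ /(_ 0%N)]; case => b bd.
    by case: (@bot1_min W b); rewrite -a0; exact: lt1_le_trans da.
pose dl := (bk a).1; pose Q := coded dl (bk a).2.
(* Without a handleable task nothing is split and the new coordinate is 0. *)
have [[da hQ]|nh] := EM (le dl a /\ handleable dl (Q `&` space T)); last first.
  exists (set0, fun=> 0); split=> //=.
  - split=> //= [x|]; first by rewrite lexx ler01.
    have -> : [set x : V | constr a (set0, fun=> 0) x] = [set x : V | x a = 0].
      by apply/seteqP; split=> x; [move=> []|left].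
    exact: closed_coord_eq.
  - by move=> da hQ; case: nh.
pose E := Q `&` space T.
have cE : compact E.
  by rewrite /E setIC; apply: compact_closedI; [exact: compact_space|exact: closed_coded].
have [uE [C0 C0P]] := hQ.
pose K := E `&` [set z | forall mu, le dl mu -> lt mu a -> ~ (T mu).1 z].
pose z0 : {classic V} := (fun=> 0) : V.
pose rp mu : V := xget z0 [set z : {classic V} | (T mu).1 z].
pose rb s : V := xget z0 [set z : {classic V} | K z /\ in_box a s z].
(* The point [p] will differ below [dl] from three kinds of points: those of [C0], so that it is
   unfrozen below [dl]; representatives of the earlier splits, so that it lies in [K]; and one point
   of [K] per rational box, so that it is a limit of [K]. *)
have [C CP] : exists C : nat -> V, forall x,
    (range C0 `|` rp @` [set mu | lt mu a] `|` range rb) x -> exists n, C n = x.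
  apply: countable_range; first exact: z0.
  apply: countable_setU; last by apply: sub_countable (card_image_le _ _) _; exact: countableP.
  apply: countable_setU; first exact: range_countable.
  by apply: sub_countable (card_image_le _ _) _; exact: countable_below.
have [p [Ep pC Up]] := U_compact C cE da uE.
have pC' x : (range C0 `|` rp @` [set mu | lt mu a] `|` range rb) x -> ~ agree dl p x.
  by move=> /CP[n <-]; exact: pC.
have Kp : K p.
  split=> // mu dmu mua Sp; apply: (pC' (rp mu)); first by left; right; exists mu.
  have Sr : (T mu).1 (rp mu) by apply: (@xgetPex {classic V} z0 [set z | (T mu).1 z]); exists p.
  by apply: agree_le dmu _; exact: clT Sp Sr.
have limK : limit_at a p K.
  move=> F e e0; apply: contrapT => nex.
  have [s [ps sF]] := box_close a F p e0.
  have [Kr rs] : K (rb s) /\ in_box a s (rb s).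
    by apply: (@xgetPex {classic V} z0 [set z | K z /\ in_box a s z]); exists p.
  have [ag|nag] := EM (agree a (rb s) p).
    apply: (pC' (rb s)); first by right; exists s.
    by apply: agree_sym; exact: agree_le ag.
  by apply: nex; exists (rb s); split=> //; exact: sF.
have [gs gsP] := countable_range (bot1 W) (countable_below a).
(* Index 0 serves the task and [m.+1] the earlier fibre of stage [gs m] through [p]; [K] fills the
   indices without such a fibre, as every [En n] must accumulate at [p]. *)
pose En n := if n is m.+1 then
  if `[< lt (gs m) a /\ (T (gs m)).1 p >] then [set z | space T z /\ (T (gs m)).1 z] else K
  else K.
have limE n : limit_at a p (En n).
  case: n => [//|m] /=; case: asboolP => [[ga Sg]|_]; last exact: limK.
  move=> F e e0; have [z [[sz zp] nz cz]] := fiber_limit gT (proj2 Ep) Sg ga F e0.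
  exists z; split=> //; split=> //; have [d1 _ _ _] := gT (gs m).
  by rewrite (d1 _ _ zp).
have [h [hd h01 hcl hosc]] := oscillating limE.
exists ([set x | agree a x p], h); split=> //=.
- split=> //= x y xy; apply/propext; split=> h'; apply: agree_trans h' => //.
  exact: agree_sym.
- by move=> x y xp yp; apply: agree_trans xp _; exact: agree_sym.
- move=> _ x mu xp mu0 mua; rewrite (U_dep (agree_le mua xp)).
  have [md|dm] := EM (lt mu dl); last exact: Up.
  by apply: (C0P p) => // n; apply: pC'; left; left; exists n.
- move=> g x t F e ga sx xp Sx t01 e0.
  have Sp : (T g).1 p.
    by have [d1 _ _ _] := gT g; rewrite -(d1 _ _ (agree_lt ga xp)).
  have [m gm] := gsP g ga.
  have [z [Ez nz cz hz]] := hosc m.+1 t F e t01 e0.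
  exists z; split=> //; last by move=> b bF ba; rewrite xp //; exact: cz.
  by move: Ez; rewrite /= gm; case: asboolP => // -[].
- move=> _ _; exists p; split=> //; first by case: Ep.
  move=> t F e t01 e0; have [z [[Ez Kz] nz cz hz]] := hosc 0%N t F e t01 e0.
  by exists z.
Qed.

Lemma construction : exists D, forall a, stage a (trunc a D) (D a).
Proof.
(* This is the default of [trunc], so the masked history of [wf_rec] is [trunc a D]. *)
pose d0 : {classic (datum W R)} := (setT, fun=> 0).
have [D DP] := wf_rec d0 (fun a T => xget d0 (stage a T : set {classic (datum W R)})).
exists D => a; elim/(well_founded_ind (@lt1_wf W)): a => a ih.
rewrite [D a]DP; apply: (@xgetPex {classic (datum W R)} d0 (stage a (trunc a D))).
apply: stage_ex.
  by apply: trunc_good => b /ih[].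
by move=> g ga; rewrite trunc_lt //; exact: st_class (ih g ga).
Qed.

End Construction.

(** * Perfect sets *)

Section PerfectSets.
Variables (W : omega_one) (R : realType).
Implicit Types (a b c g dl mu : W).
Local Notation lt := (@lt1 W).
Local Notation le a b := (~ lt1 b a).
Local Notation V := (ospace W R).
Implicit Types (x y z p : V) (F : seq W) (P : set V).

Lemma o1_sup (u : nat -> W) : exists b, forall n, lt (u n) b.
Proof.
apply: contrapT => /forallNP h; apply: (@uncountable_o1 W).
suff : [set: W] `<=` \bigcup_(n in [set: nat]) ([set b | lt b (u n)] `|` [set u n]).
  move=> /subset_card_le /sub_countable; apply; apply: bigcup_countable => // n _.
  by apply: countable_setU; [exact: countable_below|exact: countable1].
move=> b _; have /existsNP[n nb] := h b.
by exists n => //; have [->|] := le1P nb; [right|left].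
Qed.

Lemma rho_triangle a p x y : rho a p y <= rho a p x + rho a x y.
Proof.
apply: rho_le => [|b ba]; first by rewrite addr_ge0 ?rho_ge0.
apply: le_trans (lerD (rho_term_le p x ba) (rho_term_le x y ba)).
rewrite /rho_term; set c := _^-1; have c0 : 0 <= c by rewrite invr_ge0.
have := ler_normD (x b - p b) (y b - x b); rewrite addrC addrA subrK.
have := normr_ge0 (x b - p b); have := normr_ge0 (y b - x b).
set n1 := `|y b - x b|; set n2 := `|x b - p b|; set n3 := `|y b - p b| => h1 h2 h3.
rewrite ge_min; case: (leP c n2) => h4; case: (leP c n1) => h5; apply/orP;
  try (by left; lra); by right; lra.
Qed.

Definition crowded P := forall x (N : set V), P x -> nbhs x N ->
  exists y, [/\ P y, N y & y <> x].

(** A closing-off argument: every box that meets [P] contains two points of [P] that differ at some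
    coordinate, and each stage has countably many boxes. Iterating a bound for these coordinates
    omega times gives a [dl] that bounds them for all its boxes. *)
Lemma crowded_split P : crowded P -> exists dl, forall x F (e : R), P x -> 0 < e ->
  exists y z, [/\ P y, P z, close dl F e y x, close dl F e z x & ~ agree dl y z].
Proof.
move=> cP.
pose sep dl s c := forall x, P x -> in_box dl s x ->
  exists y z, [/\ P y, P z, in_box dl s y, in_box dl s z & y c <> z c].
have sepP dl s : exists c, sep dl s c.
  have [[x [Px xs]]|h] := EM (exists x, P x /\ in_box dl s x); last first.
    by exists dl => x Px xs; case: h; exists x.
  have [|y [Py ys yx]] := cP x [set y | in_box dl s y] Px.
    by apply: open_nbhs_nbhs; split=> //; exact: open_box.
  have [c yc] : exists c, y c <> x c.
    by apply: contrapT => /forallNP h; apply: yx; apply/funext => c; apply: contrapT => /h.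
  by exists c => _ _ _; exists y, x.
have nxtP dl : exists dl', lt dl dl' /\ forall s, exists2 c, lt c dl' & sep dl s c.
  have [f fP] := choice (sepP dl).
  have [u uP] := countable_range dl (countable_setU (countable1 dl)
    (sub_countable (card_image_le f setT) (countableP _))).
  have [b bP] := o1_sup u.
  exists b; split; first by have [|n <-//] := uP dl; left.
  by move=> s; exists (f s) => //; have [|n <-//] := uP (f s); right; exists s.
have [nxt nP] := choice nxtP.
pose del n := iter n nxt (bot1 W).
(* With the least bound, finitely many coordinates below [dl] already lie below one [del n]. *)
have [dl dlP dlm] := lt1_min (o1_sup del).
have below c : lt c dl -> exists n, lt c (del n).
  move=> /dlm /existsNP[n cn]; exists n.+1.
  by apply: le1_lt_trans cn _; case: (nP (del n)).
exists dl => x F e Px e0.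
have [n nF] : exists n, forall b, b \in F -> lt b dl -> lt b (del n).
  have [hF|[m /below[n mn] mF]] := seq_bounded (fun b => lt b dl) F.
    by exists 0%N => b /hF.
  by exists n => b bF bd; exact: le1_lt_trans (mF b bF bd) mn.
have [s [xs sF]] := box_close (del n) F x e0.
have [_ /(_ s)[c cn /(_ x Px xs)[y [z [Py Pz ys zs yz]]]]] := nP (del n).
exists y, z; split=> // [b bF bd|b bF bd|h].
- exact: (sF _ ys b bF (nF b bF bd)).
- exact: (sF _ zs b bF (nF b bF bd)).
- by apply: yz; apply: h; exact: lt1_trans cn (dlP n.+1).
Qed.

(** A Baire category argument for the metric [rho dl]: by [crowded_split], nested balls with centres
    in [P] can be chosen such that the ball of index [n.+1] misses [C n]; by compactness they share
    a point of [P]. *)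
Lemma crowded_unc P : compact P -> P !=set0 -> crowded P -> exists dl, unc dl P.
Proof.
move=> cP [x0 Px0] /crowded_split[dl dlP]; exists dl => C.
pose step n (q q' : V * R) := P q.1 -> 0 < q.2 -> [/\ P q'.1, 0 < q'.2,
  rho dl q.1 q'.1 + q'.2 <= q.2 & q'.2 < rho dl q'.1 (C n)].
have stepP n q : exists q', step n q q'.
  case: q => x r; have [[Px r0]|h] := EM (P x /\ 0 < r); last first.
    by exists (x, r) => /= h1 h2; case: h.
  have r20 : 0 < r / 2 by rewrite divr_gt0.
  have [F FP] := @rho_unif W R dl _ r20.
  have [x' [Px' x'x nx']] : exists x', [/\ P x', rho dl x x' <= r / 2 & ~ agree dl x' (C n)].
    have [y [z [Py Pz yx zx nyz]]] := dlP x F _ Px r20.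
    have rP w : close dl F (r / 2) w x -> rho dl x w <= r / 2.
      move=> /(FP x); rewrite (rho_agree (@agree_refl W R dl x)) subr0.
      by rewrite ger0_norm ?rho_ge0.
    have [yC|nyC] := EM (agree dl y (C n)); last by exists y; split=> //; exact: rP.
    exists z; split=> //; first exact: rP.
    by move=> zC; apply: nyz; apply: agree_trans yC _; exact: agree_sym.
  have r1 : 0 < rho dl x' (C n) by apply: rho_gt0 => h; apply: nx'; exact: agree_sym.
  exists (x', Num.min (r / 2) (rho dl x' (C n) / 2)) => _ _ /=; split=> //.
  - by rewrite lt_min r20 divr_gt0.
  - by rewrite [leRHS](splitr r) lerD // ge_min lexx.
  - by rewrite gt_min; apply/orP; right; lra.
have [st stP] := choice (fun nq : nat * (V * R) => stepP nq.1 nq.2).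
pose q := fix q n := if n is m.+1 then st (m, q m) else (x0, 1 : R).
have qP n : P (q n).1 /\ 0 < (q n).2.
  elim: n => [|n [Pn rn]] //=.
  by have [] := stP (n, q n) Pn rn.
have qS n : [/\ rho dl (q n).1 (q n.+1).1 + (q n.+1).2 <= (q n).2 &
    (q n.+1).2 < rho dl (q n.+1).1 (C n)].
  by have [Pn rn] := qP n; have [] := stP (n, q n) Pn rn.
have nest n k : rho dl (q n).1 (q (n + k)%N).1 + (q (n + k)%N).2 <= (q n).2.
  elim: k => [|k ih]; first by rewrite addn0 rho_agree // add0r.
  rewrite addnS; have [h _] := qS (n + k)%N.
  have := rho_triangle dl (q n).1 (q (n + k)%N).1 (q (n + k).+1).1; lra.
(* The amount by which [x] lies outside the [n]-th ball; a common zero lies in all balls. *)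
pose f n x : R := Num.max 0 (rho dl (q n).1 x - (q n).2).
have [|n k e e0||x Px xf] := @compact_common_zero R V nat P setT f.
- exact: cP.
- have e20 : 0 < e / 2 by rewrite divr_gt0.
  apply: filterS (rho_near dl (q n).1 k e20) => y /= h.
  have fl u v : f n u <= f n v + `|rho dl (q n).1 u - rho dl (q n).1 v|.
    have h1 : 0 <= f n v by rewrite le_max lexx.
    have h2 : rho dl (q n).1 v - (q n).2 <= f n v by rewrite le_max lexx orbT.
    have h3 := ler_norm (rho dl (q n).1 u - rho dl (q n).1 v).
    have h4 := normr_ge0 (rho dl (q n).1 u - rho dl (q n).1 v).
    by rewrite {1}/f ge_max; apply/andP; split; lra.
  have := fl y k; have := fl k y; rewrite (distrC (rho _ _ k)) ltr_norml => h1 h2.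
  by apply/andP; split; lra.
- move=> F e e0; have [m mF] : exists m, forall j, j \in F -> (j <= m)%N.
    elim: F => [|j F [m mF]]; first by exists 0%N.
    exists (maxn j m) => i; rewrite inE => /orP[/eqP->|/mF im]; first exact: leq_maxl.
    exact: leq_trans im (leq_maxr _ _).
  exists (q m).1; first by case: (qP m).
  move=> j /mF jm _; rewrite /f max_l ?normr0 // subr_le0.
  have := nest j (m - j)%N; rewrite subnKC //; have [_] := qP m; lra.
exists x => // n xC; have := xf n.+1 I; have [_ h] := qS n.
rewrite -(@rho_depends W R dl (q n.+1).1 x (C n) xC) in h => fx.
have : rho dl (q n.+1).1 x - (q n.+1).2 <= f n.+1 x by rewrite le_max lexx orbT.
by rewrite fx; lra.
Qed.

(** * Fibres inside perfect sets of the limit space *)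

Section Limit.
Variable U : W -> set V.
Hypothesis U_dep : forall mu, depends mu (U mu).
Hypothesis U_kill : forall x, exists2 mu, mu <> bot1 W & ~ U mu x.
Variable bk : W -> W * code.
Hypothesis bk_cofinal : forall t d, exists2 a, le d a & bk a = t.
Variable D : W -> datum W R.
Hypothesis D_stage : forall a, stage U bk a (trunc a D) (D a).
Local Notation X := (space D).

Lemma D_good b : good_at b (D b). Proof. by case: (D_stage b). Qed.

Lemma trunc_space a x : X x -> space (trunc a D) x.
Proof. by move=> [cx hx]; apply/(space_trunc _ _ cx) => b _; exact: hx. Qed.

Lemma trunc_constr a x : space (trunc a D) x -> forall b, lt b a -> constr b (D b) x.
Proof. by move=> sx; have [cx _] := sx; apply/(space_trunc _ _ cx). Qed.

Lemma split_agree a x y : agree a x y -> (D a).1 x -> (D a).1 y.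
Proof. by move=> xy; have [d1 _ _ _] := D_good a; rewrite (d1 _ _ xy). Qed.

Lemma unsplit_coord b x y : constr b (D b) x -> constr b (D b) y -> agree b x y ->
  ~ (D b).1 x -> x b = y b.
Proof.
move=> cx cy xy nx; have ny : ~ (D b).1 y by move=> /(split_agree (agree_sym xy)).
have [_ d2 _ _] := D_good b.
by case: cx => [->|//]; case: cy => [->|//]; exact: d2.
Qed.

(** By [st_live] a thread frozen at [mu] is not split from [mu] on, so its coordinates below [mu]
    determine the rest. *)
Lemma frozen mu x y : X x -> X y -> mu <> bot1 W -> ~ U mu x -> agree mu x y -> x = y.
Proof.
move=> [_ hx] [_ hy] mu0 nU xy.
have ns b : le mu b -> ~ (D b).1 x.
  move=> mub Sx; apply: nU; apply: (st_live (D_stage b)) => // b0.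
  by subst b; have [|] := bot1P mu.
apply/funext => b; have bxy : agree b x y.
  apply: (@unsplit_agree W R D mu b) => // [c _|c mc _].
    exact: D_good.
  exact: ns.
have [bm|mb] := EM (lt b mu); first exact: xy.
by apply: unsplit_coord => //; exact: ns.
Qed.

(** Induction on the coordinate up to which [P] attains all points over the split set of [g]. If [x]
    is split at [b], then [st_osc] gives points over that split set, near [x] and not split at [b],
    whose coordinate [b] is forced to be near [x b]; the induction hypothesis puts points of [P]
    above them, and [P] is compact. *)
Lemma irreducible g P : compact P -> P `<=` X ->
  (forall x, X x -> (D g).1 x -> exists2 y, P y & agree_le1 g y x) ->
  forall x, X x -> (D g).1 x -> P x.
Proof.
move=> cP PX base.
suff H b : le g b -> forall x, X x -> (D g).1 x -> exists2 y, P y & agree_le1 b y x.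
  move=> x Xx Sx; have [y0 Py0 _] := base x Xx Sx.
  have [|m _|y Py yx] := @compact_glue W R P setT x cP; first by exists y0.
    have [mg|gm] := EM (lt m g); last exact: H.
    have [y Py yx] := base x Xx Sx; exists y => // c cm; apply: yx.
    by apply: lt1_le; exact: le1_lt_trans mg.
  have <- // : y = x by apply/funext => c; exact: yx.
elim/(well_founded_ind (@lt1_wf W)): b => b ih gb.
have [<-|{}gb] := le1P gb; first exact: base.
have H x : X x -> (D g).1 x -> exists2 y, P y & agree b y x.
  move=> Xx Sx; have [y0 Py0 _] := base x Xx Sx.
  apply: compact_glue => //; first by exists y0.
  move=> m mb; have [mg|gm] := EM (lt m g); last exact: ih.
  have [y Py yx] := base x Xx Sx; exists y => // c cm; apply: yx.
  by apply: lt1_le; exact: le1_lt_trans mg.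
move=> x Xx Sgx; have [y Py yx] := H x Xx Sgx; have [cx hx] := Xx.
have [Sx|nx] := EM ((D b).1 x); last first.
  exists y => //; apply: agree_le1P => //.
  have [_ hy] := PX y Py; apply/esym; apply: unsplit_coord => //.
  exact: agree_sym.
apply: (@compact_approx W R P (fun c => le c b) x cP) => F e e0.
have Sgx' : (trunc b D g).1 x by rewrite trunc_lt.
have [z [[sz Sgz] nz cz hz]] :=
  st_osc (D_stage b) F gb (trunc_space b Xx) Sx Sgx' (cx b) e0.
rewrite trunc_lt // in Sgz; have [czz _] := sz.
have [z' [Xz' z'z _]] := @space_extend W R D b z D_good czz (trunc_constr sz).
have [|y' Py' y'z'] := H z' Xz'.
  by apply: split_agree Sgz; apply: agree_sym; exact: agree_lt z'z.
have y'z : agree b y' z by exact: agree_trans z'z.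
exists y' => // c cF /le1P[->|cb]; last by rewrite y'z //; exact: cz.
have [_ hy'] := PX y' Py'; have [_ d2 _ _] := D_good b.
have [->|Sy'] := hy' b; last by case: nz; exact: split_agree Sy'.
by rewrite (d2 _ _ y'z).
Qed.

(** Let [dl] be the least stage at which the projection of [P] is uncountable. Before [dl] the
    projections are countable, and by [frozen] each frozen one carries a single point of [P]; so the
    projection of [P] below [dl] is handleable. A stage [a] from [d0] on treats it, and [st_task]
    yields the base case of [irreducible] at [a]. The bound [d0] serves to find splits arbitrarily
    late. *)
Lemma crowded_contains_fiber P d0 : compact P -> P `<=` X -> P !=set0 -> crowded P ->
  exists a p, [/\ le d0 a, X p, (D a).1 p & forall x, X x -> agree a x p -> P x].
Proof.
move=> cP PX P0 /(crowded_unc cP P0) /lt1_min[dl udl dlm].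
have [c cE] := codedP dl cP.
have [d1 d01 dl1] : exists2 d1, le d0 d1 & le dl d1.
  have [h|h] := EM (lt d0 dl); [exists dl|exists d0] => //; last exact: lt1_irr.
    exact: lt1_le.
  exact: lt1_irr.
have [a d1a ba] := bk_cofinal (dl, c) d1.
have da : le dl a by exact: le1_trans d1a.
pose Q : set V := coded dl c `&` space (trunc a D).
have hQ : handleable U dl Q.
  split.
    move=> C; have [x Px xC] := udl C; exists x => //; split; first by apply/cE; exists x.
    by apply: trunc_space; exact: PX.
  have cov mu : exists C : nat -> V, lt mu dl -> forall x, P x -> exists n, agree mu x (C n).
    have [md|nd] := EM (lt mu dl); last by exists (fun=> (fun=> 0) : V) => /nd.
    have /existsNP[C hC] := dlm mu md; exists C => _ x Px.
    by apply: contrapT => /forallNP h; apply: hC; exists x.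
  have [C CP] := choice cov.
  have [ms msP] := countable_range dl (countable_below dl).
  pose z0 : {classic V} := (fun=> 0) : V.
  pose r mu n : V := xget z0 [set y : {classic V} | [/\ P y, agree mu y (C mu n) & ~ U mu y]].
  exists (fun k => let: (i, j) := odflt (0%N, 0%N) (unpickle k) in r (ms i) j).
  move=> x [/cE[y Py xy] sx] xC mu mu0 md; apply: contrapT => nU.
  have nUy : ~ U mu y by rewrite -(U_dep (agree_lt md xy)).
  have [n yn] := CP mu md y Py; have [i ei] := msP mu md.
  apply: (xC (pickle (i, n))); rewrite pickleK /= ei.
  have [Pr rn nUr] : [set y | [/\ P y, agree mu y (C mu n) & ~ U mu y]] (r mu n).
    by apply: (@xgetPex {classic V} z0); exists y.
  have <- // : y = r mu n.
  apply: (frozen (PX y Py) (PX _ Pr) mu0 nUy).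
  by apply: agree_trans yn _; exact: agree_sym.
have := st_task (D_stage a); rewrite ba /= => /(_ da hQ)[p [sp Sp osc]].
have [cp _] := sp.
have [p' [Xp' p'p _]] := @space_extend W R D a p D_good cp (trunc_constr sp).
have Sp' : (D a).1 p' by apply: split_agree Sp; exact: agree_sym.
exists a, p'; split=> //; first exact: le1_trans d1a.
move=> x Xx xp'; apply: (@irreducible a P) => //; last first.
  by apply: split_agree Sp'; exact: agree_sym.
move=> {xp' Xx}x Xx Sx; have [cx _] := Xx.
apply: (@compact_approx W R P (fun c => le c a) x cP) => F e e0.
have [z [[zQ sz] ns nz cz hz]] := osc (x a) F e (cx a) e0.
have /cE[y Py zy] := zQ; have [_ hy] := PX y Py.
have ayz : agree a z y.
  apply: (@unsplit_agree W R D dl a) => // [b _||b db ba'].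
  - exact: D_good.
  - exact: trunc_constr.
  - by have := ns b db ba'; rewrite trunc_lt.
exists y => // b bF /le1P[->|ba']; last first.
  by rewrite -(ayz b ba') (st_class (D_stage a) Sx Sp ba'); exact: cz.
have [_ d2 _ _] := D_good a.
have [->|Sy] := hy a; last by case: nz; apply: split_agree Sy; exact: agree_sym.
by rewrite -(d2 _ _ ayz).
Qed.

Lemma fiber_two_points a p : X p -> (D a).1 p ->
  exists x y, [/\ X x, X y, agree a x p, agree a y p & x a <> y a].
Proof.
move=> [cp hp] Sp.
have [|x [Xx xp x0]] := @space_extend_at W R D a p 0 D_good cp (fun b _ => hp b) Sp.
  by rewrite lexx ler01.
have [|y [Xy yp y1]] := @space_extend_at W R D a p 1 D_good cp (fun b _ => hp b) Sp.
  by rewrite lexx ler01.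
by exists x, y; split=> //; rewrite x0 y1 => /eqP; rewrite eq_sym oner_eq0.
Qed.

End Limit.
End PerfectSets.

(** * The space *)

Section Subspace.
Variables (V : topologicalType) (X : set V).

Definition carrier : Type := {x : V | `[< X x >]}.
HB.instance Definition _ := Choice.on carrier.
Definition sub_space := initial_topology (val : carrier -> V).
HB.instance Definition _ := Topological.on sub_space.
Definition incl (x : sub_space) : V := val (x : carrier).

Lemma incl_in x : X (incl x). Proof. by apply/asboolP; exact: (valP (x : carrier)). Qed.

Lemma incl_inj : injective incl. Proof. exact: val_inj. Qed.

Lemma incl_onto x : X x -> exists y, incl y = x.
Proof. by move=> Xx; exists (exist _ x (asboolT Xx)). Qed.

Lemma incl_continuous : continuous incl.
Proof. exact: (@initial_continuous carrier V val). Qed.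

Lemma incl_open (A : set sub_space) : open A -> exists2 B, open B & incl @^-1` B = A.
Proof. by move=> [B oB <-]; exists B. Qed.

Lemma incl_nbhs x (N : set sub_space) : nbhs x N ->
  exists B, [/\ open B, B (incl x) & incl @^-1` B `<=` N].
Proof. by rewrite nbhsE => -[A [/incl_open[B oB <-] Bx] AN]; exists B. Qed.

Lemma sub_hausdorff : hausdorff_space V -> hausdorff_space sub_space.
Proof.
move=> hV p q cpq; apply: incl_inj; apply: hV => A B nA nB.
have [z [Az Bz]] := cpq _ _ (incl_continuous nA) (incl_continuous nB).
by exists (incl z).
Qed.

Lemma sub_compact : compact X -> compact [set: sub_space].
Proof.
move=> cX F FF _.
have [|v [Xv cv]] := cX (fmap incl F) _.
  apply: (@filterS _ F _ setT); last exact: filterT.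
  by move=> x _; exact: (incl_in x).
have [x xv] := incl_onto Xv; exists x; split=> // A N FA /incl_nbhs[B [oB Bx BN]].
have [||z [[y Ay yz] Bz]] := cv (incl @` A) B.
- by apply: (@filterS _ F _ A) => // y Ay; exists y.
- by apply: open_nbhs_nbhs; rewrite -xv.
by exists y; split=> //; apply: BN; rewrite /= yz.
Qed.

Lemma incl_image_compact (P : set sub_space) : compact X -> closed P ->
  compact (incl @` P).
Proof.
move=> cX clP; apply: continuous_compact.
  by apply: continuous_subspaceT; exact: incl_continuous.
exact: subclosed_compact clP (sub_compact cX) _.
Qed.

Lemma incl_image_crowded (P : set sub_space) : isolated P = set0 ->
  forall v (N : set V), (incl @` P) v -> nbhs v N ->
    exists w, [/\ (incl @` P) w, N w & w <> v].
Proof.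
move=> isoP _ N [x Px <-] nN; apply: contrapT => nex.
suff : isolated P x by rewrite isoP.
split; first by rewrite inE.
exists (incl @^-1` N); first exact: incl_continuous.
apply/seteqP; split=> y; last by move=> ->; split=> //; exact: (nbhs_singleton nN).
move=> [Ny Py] /=.
apply: contrapT => yx; apply: nex; by exists (incl y); split=> // /incl_inj.
Qed.

End Subspace.

Section FinalSpace.
Variables (W : omega_one) (R : realType).
Implicit Types (a b c g dl mu : W).
Local Notation lt := (@lt1 W).
Local Notation le a b := (~ lt1 b a).
Local Notation V := (ospace W R).
Variable U : W -> set V.
Hypothesis U_dep : forall mu, depends mu (U mu).
Hypothesis U_kill : forall x : V, exists2 mu, mu <> bot1 W & ~ U mu x.
Variable bk : W -> W * code.
Hypothesis bk_cofinal : forall t d, exists2 a, le d a & bk a = t.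
Variable D : W -> datum W R.
Hypothesis D_stage : forall a, stage U bk a (trunc a D) (D a).
Local Notation X := (space D).
Local Notation T := (sub_space X).
Implicit Types (x y z : T) (P : set T) (F : seq W).

Let D_good b := D_good D_stage b.
Let X_compact : compact X := compact_space D_good.

Lemma root_extend (t : R) : 0 <= t <= 1 -> exists x, incl x (bot1 W) = t.
Proof.
move=> t01.
have [||||v [Xv _ vt]] := @space_extend_at W R D (bot1 W) (fun=> 0) t D_good.
- by move=> b; rewrite lexx ler01.
- by move=> b /bot1_min.
- by rewrite (st_bot (D_stage _)).
- exact: t01.
by have [x xv] := incl_onto Xv; exists x; rewrite xv.
Qed.

Lemma determined x : exists2 mu, mu <> bot1 W &
  forall y, agree mu (incl x) (incl y) -> x = y.
Proof.
have [mu mu0 nU] := U_kill (incl x); exists mu => // y xy.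
by apply: incl_inj; apply: (frozen D_stage _ _ mu0 nU xy); exact: incl_in.
Qed.

Lemma nbhs_close x mu (N : set T) :
  (forall y, agree mu (incl x) (incl y) -> x = y) -> nbhs x N ->
  exists F (e : R), 0 < e /\ forall y, close mu F e (incl y) (incl x) -> N y.
Proof.
move=> det /incl_nbhs[B [oB Bx BN]].
apply: contrapT => nex.
have cE : compact (X `&` ~` B) by apply: compact_closedI => //; exact: open_closedC.
have [|v [Xv nBv] vx] := @compact_approx W R (X `&` ~` B) (fun b => lt b mu) (incl x) cE.
  move=> F e e0; apply: contrapT => nex2; apply: nex; exists F, e; split=> // y yx.
  apply: BN; apply: contrapT => nB; apply: nex2; exists (incl y) => //.
  by split=> //; exact: incl_in.
have [y yv] := incl_onto Xv; apply: nBv; rewrite -yv -(det y) // => b bm.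
by rewrite yv vx.
Qed.

Lemma box_nbhs x mu (N : set T) :
  (forall y, agree mu (incl x) (incl y) -> x = y) -> nbhs x N ->
  exists s, in_box mu s (incl x) /\ forall y, in_box mu s (incl y) -> N y.
Proof.
move=> det /(nbhs_close det)[F [e [e0 h]]].
have [s [xs sF]] := box_close mu F (incl x) e0.
by exists s; split=> // y /sF /h.
Qed.

Definition box_set mu s : set T := [set y | in_box mu s (incl y)].

Lemma box_set_open mu s : open (box_set mu s).
Proof.
apply: (@open_comp _ _ (@incl _ X) [set v | in_box mu s v]); last exact: open_box.
by move=> x _; exact: incl_continuous.
Qed.

Lemma space_hausdorff : hausdorff_space T.
Proof. exact: sub_hausdorff (@ospace_hausdorff W R). Qed.

Lemma space_first_countable : first_countable T.
Proof.
move=> x; have [mu mu0 det] := determined x.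
exists [set N | exists2 s, in_box mu s (incl x) & N = box_set mu s].
  apply: sub_countable (countableP (@setT (seq (nat * (rat * rat))))).
  apply: card_le_trans (card_image_le (box_set mu) setT).
  by apply: subset_card_le => _ [s _ ->]; exists s.
split=> [_ [s xs ->]|N /(box_nbhs det)[s [xs sN]]].
  by split=> //; exact: box_set_open.
by exists (box_set mu s) => //; exists s.
Qed.

Lemma fiber_set_connected g (v : V) : connected [set x : T | agree g (incl x) v].
Proof.
set Phi := [set x | _] => B [x0 Bx0] [A oA BA] [C cC BC]; apply: contrapT => ne.
have [y Phiy nBy] : exists2 y, Phi y & ~ B y.
  apply: contrapT => nex; apply: ne; apply/seteqP; split=> y.
    by rewrite BA => -[].
  by move=> Py; apply: contrapT => nB; apply: nex; exists y.
have clPhi : closed Phi.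
  apply: (@preimage_closed T V (@incl _ X) [set w | agree g w v]); last exact: closed_agree.
  by move=> z _; exact: incl_continuous.
have cB : closed B by rewrite BC; exact: closedI.
have cB' : closed (Phi `&` ~` A) by apply: closedI => //; exact: open_closedC.
have img P : closed P -> closed (@incl _ X @` P).
  move=> cP; apply: compact_closed; first exact: ospace_hausdorff.
  exact: incl_image_compact.
have [|||w [[z Bz <-] [z' [Pz' nAz'] /incl_inj e]]] :=
    @fiber_connected W R D g v _ _ D_good (img _ cB) (img _ cB').
- by exists (incl x0), x0.
- exists (incl y), y => //; split=> // Ay; apply: nBy; rewrite BA; split=> //.
- apply/seteqP; split=> w.
    move=> [[z Bz <-]|[z [Pz _] <-]]; split; try exact: incl_in; last by [].
    by move: Bz; rewrite BA => -[].
  move=> [/incl_onto[z <-] zv]; have [Az|nA] := EM (A z).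
    by left; exists z => //; rewrite BA.
  by right; exists z.
by subst z'; apply: nAz'; move: Bz; rewrite BA => -[].
Qed.

Lemma space_connected : connected [set: T].
Proof.
have := @fiber_set_connected (bot1 W) (fun=> 0).
suff -> : [set x : T | agree (bot1 W) (incl x) (fun=> 0)] = setT by [].
by apply/seteqP; split=> // x _ b /bot1_min.
Qed.

Lemma space_perfect : perfect [set: T].
Proof.
split; [|exact: closedT|].
  by have [|x _] := @root_extend 0; [rewrite lexx ler01|exists x].
apply/seteqP; split=> // x [_ [N nN]]; rewrite setIT => Nx.
have [mu mu0 det] := determined x.
have [F [e [e0 FN]]] := nbhs_close det nN.
have b0m : lt (bot1 W) mu by have [|] := bot1P mu.
have [|z [[Xz _] nz zx]] :=
    @fiber_limit W R D (bot1 W) mu (incl x) D_good (incl_in x) _ b0m F e e0.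
  by rewrite (st_bot (D_stage _)).
have [y yz] := incl_onto Xz.
have : N y by apply: FN; rewrite yz.
by rewrite Nx => yx; apply: nz; rewrite -yz yx.
Qed.

Lemma perfect_contains_fiber P d0 : perfect P -> exists a (v : V),
  [/\ le d0 a, X v, (D a).1 v & [set x : T | agree a (incl x) v] `<=` P].
Proof.
move=> [P0 cP isoP].
have [||||a [v [da Xv Sv vP]]] := @crowded_contains_fiber W R U U_dep bk bk_cofinal D D_stage
    (@incl _ X @` P) d0.
- exact: incl_image_compact.
- by move=> _ [x _ <-]; exact: incl_in.
- by have [x Px] := P0; exists (incl x), x.
- exact: incl_image_crowded.
exists a, v; split=> // x xv.
by have [y Py /incl_inj <-] := vP (incl x) (incl_in x) xv.
Qed.

Lemma fiber_pair a (v : V) : X v -> (D a).1 v -> exists x y : T,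
  [/\ agree a (incl x) v, agree a (incl y) v & x <> y].
Proof.
move=> Xv Sv; have [x [y [/incl_onto[x' <-] /incl_onto[y' <-] xv yv ne]]] :=
  fiber_two_points D_stage Xv Sv.
by exists x', y'; split=> // e; apply: ne; rewrite e.
Qed.

Lemma space_weird : weird T.
Proof.
split; first exact: sub_compact.
  by apply; exists setT; exact: space_perfect.
move=> P /(perfect_contains_fiber (bot1 W))[a [v [_ Xv Sv vP]]] tdP.
have [x [y [xv yv xy]]] := fiber_pair Xv Sv.
have := tdP x (vP x xv); move/seteqP => [/(_ y) h _].
apply: xy; apply/esym; apply: h.
exists [set x : T | agree a (incl x) v] => //; split=> //.
exact: fiber_set_connected.
Qed.

Lemma rat_in_unit (t e : R) : 0 <= t <= 1 -> 0 < e ->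
  exists q : rat, 0 <= (ratr q : R) <= 1 /\ `|ratr q - t| < e.
Proof.
move=> /andP[t0 t1] e0.
have [t1'|] := ltP t 1; last first.
  move=> t1'; exists 1; rewrite rmorph1 ler01 lexx.
  by have -> : t = 1; [apply/le_anti; rewrite t1|rewrite subrr normr0].
have [|q] := @rat_in_itvoo R t (Num.min 1 (t + e)).
  by rewrite lt_min t1' ltrDl.
rewrite in_itv /= lt_min => /andP[q1 /andP[q2 q3]]; exists q; split.
  by rewrite (ltW q2) (le_trans t0 (ltW q1)).
by rewrite gtr0_norm ?subr_gt0 // ltrBlDl.
Qed.

Lemma space_separable : separable T.
Proof.
have [x0 _] : exists x : T, True by have [|x _] := @root_extend 0; [rewrite lexx ler01|exists x].
have lift (q : rat) : exists x : T, 0 <= (ratr q : R) <= 1 -> incl x (bot1 W) = ratr q.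
  have [/root_extend[x xq]|h] := EM (0 <= (ratr q : R) <= 1); first by exists x.
  by exists x0 => /h.
have [f fP] := choice lift.
exists (range f); first by apply: sub_countable (card_image_le _ _) _; exact: countableP.
move=> O [y Oy] oO; apply: contrapT => nex.
have fO q : ~ O (f q) by move=> Oq; apply: nex; exists (f q); split=> //; exists q.
have cP : compact (@incl _ X @` ~` O).
  by apply: incl_image_compact => //; exact: open_closedC.
have PX : (@incl _ X @` ~` O) `<=` X by move=> _ [x _ <-]; exact: incl_in.
have S0 : (D (bot1 W)).1 (incl y) by rewrite (st_bot (D_stage _)).
have [|z nOz /incl_inj e] := @irreducible W R U bk D D_stage (bot1 W) _ cP PX _
    (incl y) (incl_in y) S0; last by subst z; apply: nOz.
move=> v Xv _; apply: (@compact_approx W R _ (fun c => le c (bot1 W)) v cP) => F e e0.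
have [cv _] := Xv; have [q [q01 qv]] := rat_in_unit (cv (bot1 W)) e0.
exists (incl (f q)); first by exists (f q) => //; exact: fO.
by move=> b _ /le1P[->|/bot1_min//]; rewrite fP.
Qed.

Lemma basis_uncountable (B : set (set T)) : basis B -> ~ countable B.
Proof.
move=> [oB bB] /(countable_range setT)[u uP].
pose sep n m c := forall x y, u n x -> u m y -> incl x c <> incl y c.
have pick n m : exists c, (exists c', sep n m c') -> sep n m c.
  have [[c h]|h] := EM (exists c', sep n m c'); first by exists c.
  by exists (bot1 W) => /h.
have [c cP] := choice (fun nm : nat * nat => pick nm.1 nm.2).
have [b bP] := o1_sup (fun k => c (odflt (0%N, 0%N) (unpickle k))).
have inj x y : agree b (incl x) (incl y) -> x = y.
  move=> xy; apply: contrapT => ne.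
  have [d xyd] : exists d, incl x d <> incl y d.
    apply: contrapT => /forallNP h; apply: ne; apply: incl_inj.
    by apply/funext => d; apply: contrapT => /h.
  have e0 : 0 < `|incl x d - incl y d| / 2.
    by rewrite divr_gt0 // normr_gt0 subr_eq0; apply/eqP.
  have small z : exists2 n, u n z &
      forall t, u n t -> `|incl t d - incl z d| < `|incl x d - incl y d| / 2.
    have := bB z [set t : T | `|incl t d - incl z d| < `|incl x d - incl y d| / 2].
    have nz : nbhs z [set t : T | `|incl t d - incl z d| < `|incl x d - incl y d| / 2].
      exact: (incl_continuous (coord_near d (incl z) e0)).
    by move=> /(_ nz)[N [BN Nz] sub]; have [n un] := uP N BN; exists n; rewrite un.
  have [n xn nP] := small x; have [m ym mP] := small y.
  have sd : sep n m d.
    move=> s t /nP h1 /mP h2 st; rewrite st in h1.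
    have := ler_distD (incl t d) (incl x d) (incl y d).
    by rewrite (distrC (incl x d) (incl t d)); lra.
  have := cP (n, m) (ex_intro _ d sd); apply; [exact: xn|exact: ym|].
  by apply: xy; have := bP (pickle (n, m)); rewrite pickleK.
have [a [v [ba Xv Sv _]]] := perfect_contains_fiber b space_perfect.
have [x [y [xv yv ne]]] := fiber_pair Xv Sv; apply: ne; apply: inj.
by apply: agree_le ba _; apply: agree_trans xv _; exact: agree_sym.
Qed.

Lemma space_weight : continuum_hypothesis -> has_weight T [set: set nat].
Proof.
move=> [unc minc]; split.
- by move=> /finite_set_countable.
- pose f (i : W * seq (nat * (rat * rat))) := box_set i.1 i.2.
  have bf : basis (range f).
    split=> [_ [i _ <-]|x N nN]; first exact: box_set_open.
    have [mu _ det] := determined x; have [s [xs sN]] := box_nbhs det nN.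
    by exists (box_set mu s) => //; split=> //; exists (mu, s).
  exists (range f) => //; rewrite card_eq_le; apply/andP; split; last first.
    by apply: minc; exact: basis_uncountable.
  apply: card_le_trans (card_image_le f setT) _.
  have [j jI] : small (W * seq (nat * (rat * rat)))%type.
    apply: small_prod (small1 W) _.
    apply: (@small_inj _ _ (fun s => [set s] : set (seq (nat * (rat * rat))))); last exact: small_set.
    by move=> s s' /seteqP[/(_ s erefl)].
  have := @inj_card_eq _ _ setT j (in2W jI).
  by rewrite card_eq_le => /andP[_ h]; apply: card_le_trans h _; exact: subset_card_le.
- by move=> B bB _; apply: minc; exact: basis_uncountable.
Qed.

End FinalSpace.

Theorem theorem1p3 :
  continuum_hypothesis ->
  exists X : topologicalType,
    hausdorff_space X /\ separable X /\ first_countable X /\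
    connected [set: X] /\ weird X /\
    exists (U : Type) (K : set U), has_card_aleph1 K /\ has_weight X K.
Proof.
move=> ch; have [W] := omega_one_ex ch.
pose R : realType := Rdefinitions.R.
have [U [U_dep U_kill U_sel]] := @selector W R code set0 (@coded W R) small_code.
have [bk bkP] := @o1_enum_cofinal W (W * code)%type (bot1 W, set0)
  (small_prod (small1 W) small_code).
have [D DP] := @construction W R U U_dep U_sel bk.
exists (sub_space (space D)).
split; first exact: space_hausdorff.
split; first exact: space_separable DP.
split; first exact: (space_first_countable U_kill DP).
split; first exact: space_connected DP.
split; first exact: (space_weird U_dep U_kill bkP DP).
exists (set nat), setT; split; first exact: ch.
exact: (space_weight U_dep U_kill bkP DP ch).
Qed.
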